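(* Let $k$ be an algebraically closed field of characteristic $0$, $R=k[x,y]$, $\mathfrak m=(x,y)$, and let $L=(x^d,x^{d-1}y^{a_1},\dots,xy^{a_{d-1}},y^{a_d})$ with $0=a_0<a_1<\dots<a_d$ and $a_d>d$ be a lex-segment ideal. Let $P=k[y,z]$ and let $T(L)\subseteq P$ be the ideal generated by $z^{d-i}y^{a_i-i}$ for $i=0,\dots,d$. Then $\operatorname{depth}\operatorname{gr}_L(R)=\operatorname{depth}\operatorname{gr}_{T(L)}(P)$.
   Context: $T(L)$ is obtained from $L$ by substituting $x=yz$ in each generator $x^{d-i}y^{a_i}$ and dividing by $y^d$; it corresponds to the transform of $L$ in $R[\mathfrak m/y]\cong P$. $\operatorname{gr}_J(A)=\bigoplus_{n\ge0}J^n/J^{n+1}$. *)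

(* Defs.v *)
From HB Require Import structures.
From mathcomp Require Import all_boot all_order all_algebra.
From mathcomp Require Import mpoly.
Set Implicit Arguments. Unset Strict Implicit. Unset Printing Implicit Defensive.
Import GRing.Theory.
Local Open Scope ring_scope.

Section Graded.
Variable A : comNzRingType.

Definition ideal_gen (S : A -> Prop) (f : A) : Prop :=
  exists cs : seq (A * A), (forall p, p \in cs -> S p.2) /\
                           f = \sum_(p <- cs) p.1 * p.2.

Definition ideal_of (gs : seq A) (f : A) : Prop :=
  exists cs : seq A, size cs = size gs /\
                     f = \sum_(i < size gs) cs`_i * gs`_i.

Fixpoint powI (J : A -> Prop) (n : nat) : A -> Prop :=
  match n with
  | 0 => fun _ => True
  | n'.+1 => ideal_gen (fun f => exists a b, J a /\ powI J n' b /\ f = a * b)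
  end.

(* The associated graded ring gr_J(A) = (+)_n J^n/J^(n+1).
   An element is represented by a finite sequence u of representatives,
   u`_n in J^n being a representative of its degree-n component. *)
Definition gr_elem (J : A -> Prop) (u : seq A) : Prop :=
  forall n, powI J n u`_n.

Definition gr_eq (J : A -> Prop) (u v : seq A) : Prop :=
  forall n, powI J n.+1 (u`_n - v`_n).

Definition gr_add (u v : seq A) : seq A :=
  mkseq (fun n => u`_n + v`_n) (maxn (size u) (size v)).

Definition gr_mul (u v : seq A) : seq A :=
  mkseq (fun n => \sum_(i < n.+1) u`_i * v`_(n - i)) (size u + size v).

Definition gr_one : seq A := [:: 1].

Definition gr_in_ideal (J : A -> Prop) (us : seq (seq A)) (w : seq A) : Prop :=
  exists cs : seq (seq A),
    size cs = size us /\ (forall i, gr_elem J (nth [::] cs i)) /\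
    gr_eq J w (foldr gr_add [::]
                 [seq gr_mul (nth [::] cs i) (nth [::] us i) | i <- iota 0 (size us)]).

(* the homogeneous maximal ideal of gr_J(A) determined by a maximal ideal
   m of A containing J: (m/J) (+) (+)_{n>=1} J^n/J^(n+1) *)
Definition gr_max (m : A -> Prop) (u : seq A) : Prop := m u`_0.

Definition gr_regular (J m : A -> Prop) (us : seq (seq A)) : Prop :=
  [/\ forall i, (i < size us)%N ->
        gr_elem J (nth [::] us i) /\ gr_max m (nth [::] us i),
      forall i, (i < size us)%N -> forall w, gr_elem J w ->
        gr_in_ideal J (take i us) (gr_mul (nth [::] us i) w) ->
        gr_in_ideal J (take i us) w
    & ~ gr_in_ideal J us gr_one].

Definition gr_depth_ge (J m : A -> Prop) (r : nat) : Prop :=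
  exists us : seq (seq A), size us = r /\ gr_regular J m us.

End Graded.

(* The two polynomial rings in two variables: R = k[x,y], P = k[y,z]. *)
Definition var0 (k : comNzRingType) : {mpoly k[2]} := 'X_(@ord0 1).
Definition var1 (k : comNzRingType) : {mpoly k[2]} := 'X_(@ord_max 1).

(* L = (x^(d-i) y^(a_i) : 0 <= i <= d) in k[x,y], x = var0, y = var1 *)
Definition lexL (k : comNzRingType) (d : nat) (a : nat -> nat) : seq {mpoly k[2]} :=
  [seq var0 k ^+ (d - i) * var1 k ^+ (a i) | i <- iota 0 d.+1].

(* T(L) = (z^(d-i) y^(a_i - i) : 0 <= i <= d) in k[y,z], y = var0, z = var1 *)
Definition transT (k : comNzRingType) (d : nat) (a : nat -> nat) : seq {mpoly k[2]} :=
  [seq var1 k ^+ (d - i) * var0 k ^+ (a i - i) | i <- iota 0 d.+1].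

(* Main.v *)
Require Import Defs.
From HB Require Import structures.
From mathcomp Require Import all_boot all_order all_algebra.
From mathcomp Require Import mpoly.
From mathcomp Require Import zify.
From mathcomp Require Import ring.
Set Implicit Arguments. Unset Strict Implicit. Unset Printing Implicit Defensive.
Import GRing.Theory.
Local Open Scope ring_scope.

(** Write f_i = x^(d-i) y^(b_i) for the generators, where b_i = a_i for L, while for
    T(L) b_i = a_i - i and z plays the role of x; let I be the ideal, p the sum of
    the f_i t in gr, and height n u the least v with x^u y^v in I^n.
    By a homogeneity argument p is regular on gr as soon as no nonzero element is
    killed by all the f_i t; hence depth >= 1 iff I^(n+1) : I = I^n for all n, which
    is a condition on heights.  If p is regular, depth >= 2 iff gr/p has zero socle.
    In the extended Rees algebra B both t^-1 and y are regular modulo p, so that the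
    socles of B/(t^-1, p) and B/(y, p) vanish together.  In each bidegree (n, u), B/y
    has the single monomial x^u y^(height n u), and modulo p the degrees u > nd are
    redundant: what remains is the fiber cone, whose multiplication table only records
    for which i, n, u the inequality height (n+1) (u+d-i) <= height n u + b_i is an
    equality.  The substitution x = yz changes height n u by nd - u, which preserves
    these equalities and the condition for depth >= 1.  Finally a regular sequence of
    length 3 would be algebraically independent over k, but gr grows quadratically. *)

(** * Coefficients and monomials of bivariate polynomials *)

Section BivariateCoefficients.
Variables (k : fieldType) (ix iy : 'I_2).
Hypothesis ixy : ix != iy.
Notation A := {mpoly k[2]}.

Definition expo (u v : nat) : 'X_{1..2} := (U_(ix) *+ u + U_(iy) *+ v)%MM.
Definition mono (u v : nat) : A := 'X_[expo u v].
Definition cf (w : A) (u v : nat) : k := w@_(expo u v).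

Lemma ord2_case (j : 'I_2) : j = ix \/ j = iy.
Proof.
case: (eqVneq j ix) => [|jx]; [by left|right].
apply/val_inj; move: ixy jx; rewrite -!val_eqE /=.
by case: ix iy j => [[|[|//]] ?] [[|[|//]] ?] [[|[|//]] ?].
Qed.

Lemma expo_x u v : expo u v ix = u.
Proof. by rewrite mnmDE !mulmnE !mnm1E eqxx eq_sym (negPf ixy) mul1n mul0n addn0. Qed.

Lemma expo_y u v : expo u v iy = v.
Proof. by rewrite mnmDE !mulmnE !mnm1E eqxx (negPf ixy) mul1n mul0n. Qed.

Lemma expo_eta (m : 'X_{1..2}) : expo (m ix) (m iy) = m.
Proof. by apply/mnmP => j; case: (ord2_case j) => ->; rewrite ?expo_x ?expo_y. Qed.

Lemma expo_inj u v u' v' : expo u v = expo u' v' -> u = u' /\ v = v'.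
Proof. by move=> e; rewrite -(expo_x u v) -{2}(expo_y u v) e expo_x expo_y. Qed.

Lemma expoD u v u' v' : (expo u v + expo u' v')%MM = expo (u + u') (v + v').
Proof.
apply/mnmP => j; rewrite mnmDE.
by case: (ord2_case j) => ->; rewrite ?expo_x ?expo_y.
Qed.

Lemma monoM u v u' v' : mono u v * mono u' v' = mono (u + u') (v + v').
Proof. by rewrite /mono -mpolyXD expoD. Qed.

Lemma monoE u v : mono u v = 'X_ix ^+ u * 'X_iy ^+ v.
Proof. by rewrite /mono /expo mpolyXD -!mpolyXn. Qed.

Lemma mono00 : mono 0 0 = 1.
Proof. by rewrite monoE !expr0 mulr1. Qed.

Lemma cf_ext w w' : (forall u v, cf w u v = cf w' u v) -> w = w'.
Proof. by move=> e; apply/mpolyP => m; rewrite -(expo_eta m); apply: e. Qed.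

Lemma cf0 u v : cf 0 u v = 0. Proof. exact: mcoeff0. Qed.
Lemma cfD w w' u v : cf (w + w') u v = cf w u v + cf w' u v.
Proof. exact: mcoeffD. Qed.
Lemma cfB w w' u v : cf (w - w') u v = cf w u v - cf w' u v.
Proof. exact: mcoeffB. Qed.
Lemma cfZ c w u v : cf (c *: w) u v = c * cf w u v.
Proof. exact: mcoeffZ. Qed.
Lemma cf_sum (I : Type) (r : seq I) (Q : pred I) (F : I -> A) u v :
  cf (\sum_(i <- r | Q i) F i) u v = \sum_(i <- r | Q i) cf (F i) u v.
Proof. exact: raddf_sum. Qed.

Lemma cf_mono u v u' v' :
  cf (mono u v) u' v' = ((u == u') && (v == v'))%:R.
Proof.
rewrite /cf mcoeffX; congr ((_ : bool)%:R).
by apply/eqP/andP => [/expo_inj [-> ->]|[/eqP-> /eqP->]].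
Qed.

Lemma cfMmono w a b u v : cf (mono a b * w) u v =
  if (a <= u)%N && (b <= v)%N then cf w (u - a) (v - b) else 0.
Proof.
rewrite mulrC /cf /mono; case: ifP => [/andP[au bv]|].
  have -> : expo u v = (expo a b + expo (u - a) (v - b))%MM.
    by rewrite expoD !subnKC.
  by rewrite mcoeffMX.
move=> nle; apply/eqP; rewrite mcoeff_eq0 (perm_mem (msuppMX _ _)).
apply/negP => /mapP [m _] /mnmP e.
have ex : u = (a + m ix)%N by rewrite -(expo_x u v) e mnmDE expo_x.
have ey : v = (b + m iy)%N by rewrite -(expo_y u v) e mnmDE expo_y.
by move: nle; rewrite ex ey !leq_addr.
Qed.

Lemma cf_fin w : exists B, forall u v, (B <= u)%N || (B <= v)%N -> cf w u v = 0.
Proof.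
exists (msize w) => u v h; apply: memN_msupp_eq0; apply: (contraTN _ h) => mw.
have := msize_mdeg_lt mw; rewrite /expo mdegD !mdegMn !mdeg1 => h'.
lia.
Qed.

Lemma mono_ind (Q : A -> Prop) w : Q 0 -> (forall a b, Q a -> Q b -> Q (a + b)) ->
  (forall u v, cf w u v != 0 -> Q (cf w u v *: mono u v)) -> Q w.
Proof.
move=> Q0 QD Qm; rewrite (mpolyE w) big_seq.
apply: (big_ind Q) => // m; rewrite mcoeff_msupp -(expo_eta m).
exact: Qm.
Qed.
End BivariateCoefficients.

(* The least v such that x^u y^v lies in the n-th power of the ideal generated by
   the x^(d-i) y^(b i), 0 <= i <= d. *)
Fixpoint height (d : nat) (b : nat -> nat) (n u : nat) : nat :=
  if n is n'.+1 then
    let g (i : 'I_d.+1) := (b i + height d b n' (u - (d - i)))%N in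
    g [arg min_(i < ord_max | (d - i <= u)%N) g i]
  else 0.

(** * The height function of the powers of a monomial ideal *)

Section HeightStep.
Variables (d : nat) (b : nat -> nat).
Notation Phi := (height d b).

Lemma height_attain n u : exists i : 'I_d.+1,
  (d - i <= u)%N /\ Phi n.+1 u = (b i + Phi n (u - (d - i)))%N.
Proof.
rewrite /=; case: arg_minnP => [|i hi _]; first by rewrite subnn.
by exists i.
Qed.

Lemma height_le n u (i : nat) : (i <= d)%N -> (d - i <= u)%N ->
  (Phi n.+1 u <= b i + Phi n (u - (d - i)))%N.
Proof.
move=> id hi /=; case: arg_minnP => [|j _ hj]; first by rewrite subnn.
exact: (hj (Ordinal (id : (i < d.+1)%N))).
Qed.

End HeightStep.
Arguments height : simpl never.

Section Height.
Variables (d : nat) (b : nat -> nat).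
Notation Phi := (height d b).

Lemma height_leD n u (i : nat) : (i <= d)%N ->
  (Phi n.+1 (u + (d - i)) <= Phi n u + b i)%N.
Proof.
move=> id; have := @height_le d b n (u + (d - i)) i id (leq_addl _ _).
by rewrite addnK [(b i + _)%N]addnC.
Qed.

Lemma height_antitone n u u' : (u <= u')%N -> (Phi n u' <= Phi n u)%N.
Proof.
elim: n u u' => [|n IH] u u' uu' //.
have [i [hi ->]] := height_attain d b n u.
apply: leq_trans (height_le _ _ (ltn_ord i : (i <= d)%N) (leq_trans hi uu')) _.
  by rewrite leq_add2l IH // leq_sub2r.
Qed.

Lemma height_mono n u : (Phi n u <= Phi n.+1 u)%N.
Proof.
elim: n u => [|n IH] u //.
have [i [hi ->]] := height_attain d b n.+1 u.
have id : (i <= d)%N by rewrite -ltnS.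
by apply: leq_trans (height_le _ _ id hi) _; rewrite leq_add2l.
Qed.

Lemma height_monotone n m u : (n <= m)%N -> (Phi n u <= Phi m u)%N.
Proof.
elim: m => [|m IH]; first by rewrite leqn0 => /eqP->.
rewrite leq_eqVlt => /orP [/eqP->//|]; rewrite ltnS => /IH h.
exact: leq_trans h (height_mono _ _).
Qed.

(** This reflects that I^n I^m lies in I^(n+m); generators of the first factor are split off one at
    a time. *)
Lemma height_subadd n m u u' : (Phi (n + m) (u + u') <= Phi n u + Phi m u')%N.
Proof.
elim: n u => [|n IH] u; first by rewrite !add0n height_antitone ?leq_addl.
have [i [hi ->]] := height_attain d b n u.
have id : (i <= d)%N by rewrite -ltnS.
rewrite addSn; apply: leq_trans (height_le _ _ id (leq_trans hi (leq_addr _ _))) _.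
by rewrite -addnA leq_add2l -addnBAC.
Qed.

Lemma height_eq0 n u : b 0 = 0%N -> (n * d <= u)%N -> Phi n u = 0%N.
Proof.
move=> b0; elim: n u => [|n IH] u // h; apply/eqP; rewrite -leqn0.
apply: leq_trans (@height_le d b n u 0 (leq0n _) _) _; first lia.
rewrite b0 IH //; lia.
Qed.

Lemma height_bound n u : (Phi n u <= n * b d)%N.
Proof.
elim: n u => [|n IH] u //; apply: leq_trans (@height_le d b n u d (leqnn _) _) _; first lia.
by rewrite mulSn leq_add2l.
Qed.
End Height.

(** * Powers of the monomial ideal, described by coefficients *)

Section MonomialPowers.
Variables (k : fieldType) (ix iy : 'I_2).
Hypothesis ixy : ix != iy.
Variables (d : nat) (b : nat -> nat).
Notation A := {mpoly k[2]}.
Notation Phi := (height d b).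
Notation cf := (cf ix iy).
Notation mono := (mono k ix iy).

Definition generator (i : nat) : A := mono (d - i) (b i).
Notation gen := generator.
Definition gens : seq A := [seq gen i | i <- iota 0 d.+1].
(** A polynomial lies in a monomial ideal exactly when its monomials do, so membership in I^n
    becomes a linear condition on coefficients; [powI_gens] justifies this encoding. *)
Definition inI (n : nat) (w : A) : Prop :=
  forall u v, (v < Phi n u)%N -> cf w u v = 0.

Lemma inI00 n : inI n 0. Proof. by move=> u v _; rewrite cf0. Qed.
Lemma inID n w w' : inI n w -> inI n w' -> inI n (w + w').
Proof. by move=> h h' u v uv; rewrite cfD h ?h' ?addr0. Qed.
Lemma inIB n w w' : inI n w -> inI n w' -> inI n (w - w').
Proof. by move=> h h' u v uv; rewrite cfB h ?h' ?subr0. Qed.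
Lemma inIZ n c w : inI n w -> inI n (c *: w).
Proof. by move=> h u v uv; rewrite cfZ h ?mulr0. Qed.
Lemma inI_sum n (I : Type) (r : seq I) (Q : pred I) (F : I -> A) :
  (forall i, Q i -> inI n (F i)) -> inI n (\sum_(i <- r | Q i) F i).
Proof. move=> h; elim/big_ind: _ => //; [exact: inI00|exact: inID]. Qed.
Lemma inI0 w : inI 0 w. Proof. by []. Qed.

Lemma inI_le n m w : (n <= m)%N -> inI m w -> inI n w.
Proof. by move=> nm h u v uv; apply: h; apply: leq_trans uv (height_monotone _ _ _ nm). Qed.

Lemma inIS n w : inI n.+1 w -> inI n w.
Proof. exact/inI_le/leqnSn. Qed.

Lemma inI_mono n u v : (Phi n u <= v)%N -> inI n (mono u v).
Proof.
move=> h u' v' uv; rewrite cf_mono //; case: andP => // -[/eqP e /eqP e'].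
by move: uv; rewrite -e -e' ltnNge h.
Qed.

Lemma inIMmono n m u v w : (Phi n u <= v)%N -> inI m w -> inI (n + m) (mono u v * w).
Proof.
move=> h hw u' v' uv; rewrite cfMmono //; case: ifP => // /andP [uu' vv'].
apply: hw; have := height_subadd d b n m u (u' - u); rewrite subnKC //; lia.
Qed.

Lemma inIM n m w w' : inI n w -> inI m w' -> inI (n + m) (w * w').
Proof.
move=> hw hw'; pattern w; apply: (mono_ind ixy (w := w)).
- by rewrite mul0r; apply: inI00.
- by move=> x y hx hy; rewrite mulrDl; apply: inID.
move=> u v nz; rewrite -scalerAl; apply/inIZ/inIMmono => //.
by rewrite leqNgt; apply: contra nz => /hw ->.
Qed.

Lemma inI_mull m w w' : inI m w' -> inI m (w * w').
Proof. exact: (inIM (inI0 w)). Qed.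

Lemma inI_gen i : (i <= d)%N -> inI 1 (gen i).
Proof.
move=> id; apply: inI_mono; apply: leq_trans (height_le _ _ id (leqnn _)) _.
by rewrite addn0.
Qed.

Lemma inI_genM i n w : (i <= d)%N -> inI n w -> inI n.+1 (gen i * w).
Proof. by move=> id hw; apply: (@inIM 1 n _ w) => //; apply: inI_gen. Qed.

Lemma size_gens : size gens = d.+1. Proof. by rewrite size_map size_iota. Qed.
Lemma nth_gens i : (i < d.+1)%N -> gens`_i = gen i.
Proof. by move=> id; rewrite (nth_map 0%N) ?size_iota // nth_iota. Qed.

Lemma ideal_gens_gen i : (i <= d)%N -> ideal_of gens (gen i).
Proof.
move=> id; exists (mkseq (fun j => (j == i)%:R) d.+1); rewrite size_mkseq size_gens.
split=> //; rewrite (bigD1 (Ordinal (id : (i < d.+1)%N))) //= big1 => [|j ji].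
  by rewrite nth_mkseq // eqxx mul1r nth_gens // addr0.
by rewrite nth_mkseq // [_ == i](negPf ji) mul0r.
Qed.

Lemma ideal_gens_inI w : ideal_of gens w -> inI 1 w.
Proof.
move=> [cs [_ ->]]; apply: inI_sum => i _; apply: inI_mull.
have id : (i < d.+1)%N by rewrite -size_gens.
by rewrite nth_gens //; apply: inI_gen.
Qed.

Lemma powI_D (J : A -> Prop) n w w' : powI J n w -> powI J n w' -> powI J n (w + w').
Proof.
case: n => [|n] //= [cs [h ->]] [cs' [h' ->]]; exists (cs ++ cs'); split.
  by move=> p; rewrite mem_cat => /orP [/h|/h'].
by rewrite big_cat.
Qed.

(** A monomial satisfying [inI n.+1] factors as a generator attaining the height times a monomial
    satisfying [inI n], and such monomials span. *)
Lemma powI_gens n w : powI (ideal_of gens) n w <-> inI n w.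
Proof.
elim: n w => [|n IH] w //; split.
  move=> [cs [h ->]]; rewrite big_seq; apply: inI_sum => p /h [x [y [hx [hy ->]]]].
  by apply: inI_mull; apply: (@inIM 1); [apply: ideal_gens_inI|apply/IH].
move=> hw; apply: (mono_ind ixy (w := w)).
- by exists [::]; rewrite big_nil.
- exact: powI_D.
move=> u v nz; exists [:: ((cf w u v)%:MP, mono u v)]; split; last first.
  by rewrite big_seq1 mul_mpolyC.
move=> p; rewrite inE => /eqP -> /=.
have : (Phi n.+1 u <= v)%N by rewrite leqNgt; apply: contra nz => /hw ->.
have [i [iu ->]] := height_attain d b n u => hv.
have id : (i <= d)%N by rewrite -ltnS.
exists (gen i), (mono (u - (d - i)) (v - b i)); split; first exact: ideal_gens_gen.
split; last by rewrite monoM //; congr (mono _ _); lia.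
by apply/IH/inI_mono; lia.
Qed.
End MonomialPowers.

(** * Cancelling a sum of homogeneous elements of distinct degrees *)

Section HomogeneousCancellation.
Variables (E : comNzRingType) (pi : nat -> E -> E) (D : E -> Prop).
Variables (Z : nat -> E -> Prop) (r : nat) (H : nat -> E) (e : nat -> nat).
Hypothesis Z0 : forall m, Z m 0.
Hypothesis ZD : forall m x y, Z m x -> Z m y -> Z m (x + y).
Hypothesis ZB : forall m x y, Z m x -> Z m y -> Z m (x - y).
Hypothesis Zpi : forall m n w, Z m w -> Z m (pi n w).
Hypothesis piD : forall n x y, pi n (x + y) = pi n x + pi n y.
Hypothesis pi0 : forall n, pi n 0 = 0.
Hypothesis Zdec : forall m w, D w -> (forall n, Z m (pi n w)) -> Z m w.
Hypothesis pifin : forall w, exists B, forall n, (B <= n)%N -> pi n w = 0.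
Hypothesis HD : forall i w, (i < r)%N -> D w -> D (H i * w).
Hypothesis HZ : forall i m w, (i < r)%N -> Z m w -> Z m.+1 (H i * w).
Hypothesis piH : forall i n w, (i < r)%N -> pi (n + e i) (H i * w) = H i * pi n w.
Hypothesis piH0 : forall i n w, (i < r)%N -> (n < e i)%N -> pi n (H i * w) = 0.
Hypothesis e_incr : forall i j, (i < j)%N -> (j < r)%N -> (e i < e j)%N.
Hypothesis cancelH : forall m n w, D w ->
  (forall i, (i < r)%N -> Z m.+1 (H i * pi n w)) -> Z m (pi n w).

Let Z_sum m (s : seq nat) (Q : pred nat) F :
  (forall i, i \in s -> Q i -> Z m (F i)) -> Z m (\sum_(i <- s | Q i) F i).
Proof.
move=> h; rewrite big_seq_cond; elim/big_ind: _ => //; first exact: ZD.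
by move=> i /andP []; apply: h.
Qed.

Let pi_sum n (s : seq nat) (F : nat -> E) :
  pi n (\sum_(i <- s) F i) = \sum_(i <- s) pi n (F i).
Proof. by elim: s => [|i s IH]; rewrite ?big_nil ?pi0 // !big_cons piD IH. Qed.

(** In degree lo + len + e i of the product only [H i] times the top component of w matters: the
    terms l > i are disposed of by hypothesis, and a term l < i would need a component of w above
    the top one. *)
Lemma top_component m lo len w i : D w -> (i < r)%N ->
  (forall n, (lo + len < n)%N -> Z m (pi n w)) ->
  Z m.+1 ((\sum_(0 <= l < r) H l) * w) ->
  (forall l, (i < l)%N -> (l < r)%N -> Z m.+1 (H l * w)) ->
  Z m.+1 (H i * pi (lo + len)%N w).
Proof.
move=> Dw ir hout hsum hgt.
have low : Z m.+1 (\sum_(0 <= l < i.+1) H l * w).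
  have -> : \sum_(0 <= l < i.+1) H l * w =
      (\sum_(0 <= l < r) H l) * w - \sum_(i.+1 <= l < r) H l * w.
    by rewrite mulr_suml [X in X - _](big_cat_nat (n := i.+1)) //= addrK.
  apply: ZB => //; apply: Z_sum => l; rewrite mem_index_iota => /andP [il lr] _.
  exact: hgt.
have := Zpi (lo + len + e i) low.
rewrite big_nat_recr //= piD piH // pi_sum => /ZB
  -/(_ (\sum_(0 <= l < i) pi (lo + len + e i) (H l * w))).
rewrite [_ + H i * _]addrC addrK; apply; apply: Z_sum => l.
rewrite mem_index_iota => /andP [_ li] _.
have lr := ltn_trans li ir; have el := e_incr li ir.
have -> : (lo + len + e i = (lo + len + (e i - e l)) + e l)%N by lia.
rewrite piH //; apply: HZ => //.
by apply: hout; lia.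
Qed.

(* Induction on the length of the range of degrees of w whose components are
   possibly nonzero: multiplying by H i kills the top one and shifts the others. *)
Lemma cancel_sum_range len lo m w : D w ->
  (forall n, (n < lo)%N || (lo + len <= n)%N -> Z m (pi n w)) ->
  Z m.+1 ((\sum_(0 <= l < r) H l) * w) -> Z m w.
Proof.
elim: len lo m w => [|len IH] lo m w Dw hout hsum.
  by apply: Zdec => // n; apply: hout; lia.
have hout' n : (lo + len < n)%N -> Z m (pi n w) by move=> h; apply: hout; lia.
have all_i i : (i < r)%N -> Z m.+1 (H i * w).
  (* Descending induction on i, since [top_component] needs the later terms first. *)
  have [j] := ubnP (r - i); elim: j i => // j IHj i hj ir.
  have htop := @top_component m lo len w i Dw ir hout' hsum.
  have {}htop : Z m.+1 (H i * pi (lo + len)%N w).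
    by apply: htop => l il lr; apply: IHj => //; lia.
  (* The top component of [H i * w] is now negligible, so its range of degrees has length len and
     starts at lo + e i. *)
  apply: (IH (lo + e i)%N); first exact: HD.
    move=> n hn; case: (ltnP n (e i)) => ni; first by rewrite piH0.
    have -> : (n = (n - e i) + e i)%N by lia.
    rewrite piH //; case: (eqVneq (n - e i)%N (lo + len)%N) => [-> //|ne].
    by apply: HZ => //; apply: hout; lia.
  by rewrite mulrCA; apply: HZ.
have top : Z m (pi (lo + len)%N w).
  by apply: cancelH => // i ir; rewrite -piH //; apply/Zpi/all_i.
apply: (IH lo) => // n hn; case: (eqVneq n (lo + len)%N) => [-> //|ne].
by apply: hout; lia.
Qed.

(** The grading takes the place of prime avoidance: an explicit sum is cancellable as soon as no
    homogeneous component is killed by all summands. It serves for [genP], graded by x-degree, and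
    for [pol2], graded by t-degree. *)
Lemma cancel_sum m w : D w -> Z m.+1 ((\sum_(0 <= l < r) H l) * w) -> Z m w.
Proof.
move=> Dw; have [B hB] := pifin w.
by apply: (@cancel_sum_range B 0) => // n hn; rewrite hB.
Qed.
End HomogeneousCancellation.

(** * Regularity of p on the associated graded ring *)

Section GenericElement.
Variables (k : fieldType) (ix iy : 'I_2).
Hypothesis ixy : ix != iy.
Variables (d : nat) (b : nat -> nat).
Notation A := {mpoly k[2]}.
Notation Phi := (height d b).
Notation cf := (cf ix iy).
Notation mono := (mono k ix iy).
Notation gen := (generator k ix iy d b).
Notation inI := (inI ix iy d b).

Definition xpart (n : nat) (w : A) : A :=
  \sum_(m <- msupp w | m ix == n) w@_m *: 'X_[m].

Lemma cf_xpart n w u v : cf (xpart n w) u v = if u == n then cf w u v else 0.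
Proof.
rewrite cf_sum big_mkcond; case: ifP => [/eqP <-|un]; last first.
  apply: big1 => m _; case: ifP => // /eqP mn; rewrite cfZ -(expo_eta ixy m) -/(mono _ _).
  by rewrite cf_mono // mn [_ == u]eq_sym un mulr0.
rewrite [in RHS](mpolyE w) cf_sum; apply: eq_bigr => m _.
case: ifP => // mu; rewrite cfZ -(expo_eta ixy m) -/(mono _ _).
by rewrite cf_mono // mu mulr0.
Qed.

Definition genP : A := \sum_(0 <= i < d.+1) gen i.

(** The inclusion of I^(m+1) : I in I^m for every m; equivalently, all powers of I are Ratliff-Rush
    closed. *)
Definition colon_closed := forall m w,
  (forall i, (i <= d)%N -> inI m.+1 (gen i * w)) -> inI m w.

Lemma genP_cancel : colon_closed -> forall m w, inI m.+1 (genP * w) -> inI m w.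
Proof.
(* The order is reversed so that summand i has x-degree i, increasing as [cancel_sum] requires. *)
move=> Pc m w; have -> : genP = \sum_(0 <= i < d.+1) gen (d - i).
  rewrite /genP big_nat_rev /= add0n; apply: eq_big_nat => i _.
  by rewrite subSS.
apply: (@cancel_sum _ xpart (fun _ => True) inI d.+1 _ id) => //.
- exact: inI00.
- exact: inID.
- exact: inIB.
- move=> m' n x hx u v uv; rewrite cf_xpart; case: ifP => // _; exact: hx.
- move=> n x y; apply: (cf_ext ixy) => u v; rewrite cfD !cf_xpart cfD.
  by case: ifP => // _; rewrite addr0.
- by move=> n; apply: (cf_ext ixy) => u v; rewrite cf_xpart cf0; case: ifP.
- by move=> m' x _ hx u v uv; have := hx u u v uv; rewrite cf_xpart eqxx.
- move=> x; have [B hB] := cf_fin ixy x; exists B => n hn.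
  apply: (cf_ext ixy) => u v; rewrite cf_xpart cf0; case: eqP => // ->.
  by rewrite hB ?hn.
- by move=> i m' x ir hx; apply: inI_genM => //; lia.
- move=> i n x ir; apply: (cf_ext ixy) => u v; rewrite cf_xpart !cfMmono //.
  rewrite cf_xpart; have -> : (d - (d - i) = i)%N by lia.
  case: (leqP i u) => iu /=; last by case: ifP.
  by have -> : (u == n + i)%N = (u - i == n)%N by [lia]; case: ifP; case: ifP.
- move=> i n x ir ni; apply: (cf_ext ixy) => u v; rewrite cf_xpart cf0.
  case: eqP => // ->; rewrite cfMmono //; case: ifP => //; lia.
move=> m' n x _ h; apply: Pc => i id.
by have := h (d - i)%N; rewrite subKn //; apply; lia.
Qed.
End GenericElement.

(** * Multiplication operators of the Rees algebra modulo y *)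

Section FiberOperators.
Variables (k : fieldType) (d : nat) (b : nat -> nat).
Notation Phi := (height d b).

Lemma coef_over (c : {poly k}) u : (size c <= u)%N -> c`_u = 0.
Proof. exact: nth_default. Qed.

(** Here c stands for the sum of the c_u x^u y^(height n u) modulo y I^n. Multiplication by f_i
    sends a basis monomial to a basis monomial, or to 0 when the product falls into y I^(n+1). *)
Definition op (n i : nat) (c : {poly k}) : {poly k} :=
  \poly_(u < size c + d)
    (if (d - i <= u)%N && (Phi n (u - (d - i)) + b i == Phi n.+1 u)%N
     then c`_(u - (d - i)) else 0).

Lemma coef_op n i c u : (op n i c)`_u =
  if (d - i <= u)%N && (Phi n (u - (d - i)) + b i == Phi n.+1 u)%N
  then c`_(u - (d - i)) else 0.
Proof.
rewrite coef_poly; case: ltnP => // h; case: ifP => // _.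
by rewrite coef_over //; lia.
Qed.

Lemma opD n i c c' : op n i (c + c') = op n i c + op n i c'.
Proof. by apply/polyP => u; rewrite coefD !coef_op coefD; case: ifP; rewrite ?addr0. Qed.
Lemma opB n i c c' : op n i (c - c') = op n i c - op n i c'.
Proof. by apply/polyP => u; rewrite coefB !coef_op coefB; case: ifP; rewrite ?subr0. Qed.
Lemma op0 n i : op n i 0 = 0.
Proof. by apply/polyP => u; rewrite coef0 !coef_op coef0; case: ifP. Qed.

Definition pop (n : nat) (c : {poly k}) : {poly k} := \sum_(0 <= l < d.+1) op n l c.

Lemma popD n c c' : pop n (c + c') = pop n c + pop n c'.
Proof. by rewrite -big_split /=; apply: eq_bigr => l _; rewrite opD. Qed.
Lemma popB n c c' : pop n (c - c') = pop n c - pop n c'.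
Proof. by rewrite -sumrB; apply: eq_bigr => l _; rewrite opB. Qed.

Lemma size_op n i (c : {poly k}) :
  (size c <= (n * d).+1)%N -> (size (op n i c) <= (n.+1 * d).+1)%N.
Proof. by move=> h; apply: leq_trans (size_poly _ _) _; lia. Qed.

End FiberOperators.

(** * Reduction modulo y and modulo p *)

Section InitialForms.
Variables (k : fieldType) (ix iy : 'I_2).
Hypothesis ixy : ix != iy.
Variables (d : nat) (b : nat -> nat).
Hypothesis b0 : b 0 = 0%N.
Notation A := {mpoly k[2]}.
Notation Phi := (height d b).
Notation cf := (cf ix iy).
Notation mono := (mono k ix iy).
Notation gen := (generator k ix iy d b).
Notation inI := (inI ix iy d b).
Notation genP := (genP k ix iy d b).
Notation Y := (mono 0 1).
Notation op := (op d b).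
Notation pop := (pop d b).

(* [bottom n] identifies I^n / y I^n with k[X]; multiplication by the i-th generator
   becomes [op n i]. *)
Definition bottom (n : nat) (w : A) : {poly k} :=
  \poly_(u < msize w) cf w u (Phi n u).

Lemma coef_bottom n w u : (bottom n w)`_u = cf w u (Phi n u).
Proof.
rewrite coef_poly; case: ltnP => // h; apply/esym/memN_msupp_eq0.
apply: (contraTN _ h) => mw; rewrite -ltnNge; apply: leq_ltn_trans (msize_mdeg_lt mw).
by rewrite /expo mdegD !mdegMn !mdeg1; lia.
Qed.

Definition lift (n : nat) (c : {poly k}) : A :=
  \sum_(0 <= u < size c) c`_u *: mono u (Phi n u).

Lemma inI_lift n c : inI n (lift n c).
Proof. by apply: inI_sum => u _; apply/inIZ/inI_mono. Qed.

Lemma bottom_lift n c : bottom n (lift n c) = c.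
Proof.
apply/polyP => u; rewrite coef_bottom cf_sum.
under eq_bigr do rewrite cfZ cf_mono //.
case: (ltnP u (size c)) => h.
  rewrite (bigD1_seq u) ?mem_index_iota ?iota_uniq //= !eqxx mulr1.
  by rewrite big1 ?addr0 // => i /negPf ->; rewrite mulr0.
rewrite [RHS]nth_default // big_nat big1 // => i hi.
by have -> : (i == u) = false by [lia]; rewrite mulr0.
Qed.

Lemma bottomD n w w' : bottom n (w + w') = bottom n w + bottom n w'.
Proof. by apply/polyP => u; rewrite coefD !coef_bottom cfD. Qed.
Lemma bottomB n w w' : bottom n (w - w') = bottom n w - bottom n w'.
Proof. by apply/polyP => u; rewrite coefB !coef_bottom cfB. Qed.
Lemma bottom0 n : bottom n 0 = 0.
Proof. by apply/polyP => u; rewrite coef0 coef_bottom cf0. Qed.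
Lemma bottom_sum n (s : seq nat) F :
  bottom n (\sum_(i <- s) F i) = \sum_(i <- s) bottom n (F i).
Proof. by elim: s => [|i s IH]; rewrite ?big_nil ?bottom0 // !big_cons bottomD IH. Qed.

Lemma bottom_Y n w : inI n w -> bottom n (Y * w) = 0.
Proof.
move=> h; apply/polyP => u; rewrite coef_bottom coef0 cfMmono //.
by case: ifP => // /andP [_ h1]; rewrite subn0 h //; lia.
Qed.

Lemma y_shift (w : A) : exists w0, forall u v, cf w0 u v = cf w u v.+1.
Proof.
pattern w; apply: (mono_ind ixy (w := w)).
- by exists 0 => u v; rewrite !cf0.
- move=> x y [x0 hx] [y0 hy]; exists (x0 + y0) => u v.
  by rewrite !cfD hx hy.
move=> u [|v] _; [exists 0|exists (cf w u v.+1 *: mono u v)] => u' v'.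
  by rewrite cf0 cfZ cf_mono // andbF mulr0.
by rewrite !cfZ !cf_mono.
Qed.

(** If the lowest coefficients vanish, every monomial of w lies strictly above the height, so y can
    be divided off inside I^n. *)
Lemma bottom_eq0 n w : inI n w -> bottom n w = 0 -> exists2 w', inI n w' & w = Y * w'.
Proof.
move=> h h0; have [w0 hw0] := y_shift w.
have hb u v : (v <= Phi n u)%N -> cf w u v = 0.
  rewrite leq_eqVlt => /orP [/eqP ->|]; last exact: h.
  by rewrite -coef_bottom h0 coef0.
exists w0 => [u v uv|]; first by rewrite hw0 hb.
apply: (cf_ext ixy) => u [|v]; rewrite cfMmono // ?leq0n /=; first by rewrite hb.
by rewrite subn0 subn1 hw0.
Qed.

(** By [height_leD] the product of f_i with a lowest monomial lies on or above the height in degree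
    n+1, and only equality contributes to [bottom]. *)
Lemma bottom_gen n i w : (i <= d)%N -> inI n w ->
  bottom n.+1 (gen i * w) = op n i (bottom n w).
Proof.
move=> id h; apply/polyP => u; rewrite coef_op !coef_bottom cfMmono //.
case: (leqP (d - i) u) => //= hu.
have hle := height_leD b n (u - (d - i)) id; rewrite subnK // in hle.
case: eqP => [<-|/eqP ne]; first by rewrite leq_addl addnK.
by case: ifP => // bi; apply: h; lia.
Qed.

(** Inherited through [lift] from commutativity of the polynomial ring. *)
Lemma op_comm n i j (c : {poly k}) : (i <= d)%N -> (j <= d)%N ->
  op n.+1 i (op n j c) = op n.+1 j (op n i c).
Proof.
move=> id jd; have h := @inI_lift n c; rewrite -(bottom_lift n c).
rewrite -!bottom_gen //; try exact: inI_genM.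
by rewrite mulrCA.
Qed.

Lemma op_pop n i (c : {poly k}) : (i <= d)%N -> op n.+1 i (pop n c) = pop n.+1 (op n i c).
Proof.
move=> id; rewrite /pop.
have -> : forall s : seq nat, all (fun l => l <= d)%N s ->
    op n.+1 i (\sum_(l <- s) op n l c) = \sum_(l <- s) op n.+1 l (op n i c).
  elim=> [|l s IH] /=; first by rewrite !big_nil op0.
  by move=> /andP [ld /IH e]; rewrite !big_cons opD e op_comm.
  by [].
by apply/allP => l; rewrite mem_index_iota.
Qed.

Lemma bottom_genP n w : inI n w -> bottom n.+1 (genP * w) = pop n (bottom n w).
Proof.
move=> h; rewrite mulr_suml bottom_sum; apply: eq_big_nat => i hi.
by rewrite bottom_gen.
Qed.

Lemma inI_genP n w : inI n w -> inI n.+1 (genP * w).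
Proof.
move=> h; rewrite mulr_suml big_nat; apply: inI_sum => i hi.
exact: inI_genM.
Qed.

(** The degree n part of the ideal (y, p) of the extended Rees algebra B. Truncating n - 1 at n = 0
    is correct, because B has component A in every degree at most 0. *)
Definition modYP (n : nat) (w : A) : Prop :=
  exists x y, [/\ inI n x, inI n.-1 y & w = Y * x + genP * y].

Lemma modYP_bottom n w : inI n.+1 w ->
  modYP n.+1 w <-> exists g, bottom n.+1 w = pop n g.
Proof.
move=> h; split=> [[x [y [hx hy ->]]]|[g hg]].
  by exists (bottom n y); rewrite bottomD bottom_Y // add0r bottom_genP.
have hl := @inI_lift n g.
have [|x hx e] := @bottom_eq0 n.+1 (w - genP * lift n g) (inIB h (inI_genP hl)).
  by rewrite bottomB bottom_genP // bottom_lift hg subrr.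
by exists x, (lift n g); split=> //; rewrite -e subrK.
Qed.

Definition socle_modY := forall n w, inI n.+1 w ->
  (forall i, (i <= d)%N -> modYP n.+2 (gen i * w)) -> modYP n.+1 w.

Definition socle_poly := forall n (c : {poly k}),
  (forall i, (i <= d)%N -> exists g, op n.+1 i c = pop n.+1 g) ->
  exists g, c = pop n g.

Lemma socle_modY_poly : socle_modY <-> socle_poly.
Proof.
split=> hs n c.
  move=> h; have hl := @inI_lift n.+1 c.
  have /(modYP_bottom hl) : modYP n.+1 (lift n.+1 c).
    apply: hs => // i id; apply/modYP_bottom; first exact: inI_genM.
    by rewrite bottom_gen // bottom_lift; apply: h.
  by rewrite bottom_lift.
move=> hc h; apply/modYP_bottom => //; apply: hs => i id.
by rewrite -bottom_gen //; apply/modYP_bottom; [apply: inI_genM|apply: h].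
Qed.

(** The size bounds keep the x-degrees u at most nd in degree n. This is the form that is compared
    between L and T(L). *)
Definition fiber_socle := forall n (c : {poly k}), (size c <= (n.+1 * d).+1)%N ->
  (forall i, (i <= d)%N ->
     exists2 g : {poly k}, (size g <= (n.+1 * d).+1)%N & op n.+1 i c = pop n.+1 g) ->
  exists2 g : {poly k}, (size g <= (n * d).+1)%N & c = pop n g.

(** Above x-degree nd the heights vanish and f_0 = x^d acts as a plain shift by d; every other
    generator shifts by less and cannot reach this coefficient. *)
Lemma coef_pop_top n (c : {poly k}) : (n * d < (size c).-1)%N ->
  (pop n c)`_((size c).-1 + d) = lead_coef c.
Proof.
move=> h; rewrite coef_sum big_ltn // big_nat big1 ?addr0 => [|l hl]; rewrite coef_op.
  rewrite subn0 leq_addl addnK b0 addn0 !height_eq0 ?eqxx //; lia.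
case: ifP => // _; rewrite coef_over //; lia.
Qed.

Lemma size_pop_inv n (c : {poly k}) :
  (size (pop n c) <= (n.+1 * d).+1)%N -> (size c <= (n * d).+1)%N.
Proof.
move=> h; rewrite leqNgt; apply/negP => h'.
have := @coef_pop_top n c; rewrite coef_over; last lia.
move=> e; have /esym/eqP : 0 = lead_coef c by apply: e; lia.
by rewrite lead_coef_eq0 => /eqP c0; rewrite c0 size_poly0 in h'.
Qed.

(** Long division: as long as the degree exceeds (n+1)d, the leading term is cancelled by a multiple
    of p. *)
Lemma pop_reduce n (c : {poly k}) : exists g, (size (c - pop n g)%R <= (n.+1 * d).+1)%N.
Proof.
have [m] := ubnP (size c); elim: m c => // m IH c hm.
case: (leqP (size c) (n.+1 * d).+1) => hc.
  exists 0; rewrite /pop big1 ?subr0 // => l _; exact: op0.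
(* The degree s - d still exceeds nd, so by [coef_pop_top] the leading terms of [pop n g] and c
   agree. *)
pose s := (size c).-1; pose g : {poly k} := lead_coef c *: 'X^(s - d).
have hl0 : lead_coef c != 0.
  by rewrite lead_coef_eq0 -size_poly_eq0 -lt0n; lia.
have sg : size g = (s - d).+1 by rewrite size_scale // size_polyXn.
have hs : (size (c - pop n g)%R <= s)%N.
  apply/leq_sizeP => j hj; rewrite coefB.
  have [-> {hj}|ne] := eqVneq j s.
    have := @coef_pop_top n g; rewrite sg /= subnK; last by rewrite /s; lia.
    rewrite lead_coefZ lead_coefXn mulr1 => ->; last by rewrite /s; lia.
    by rewrite /lead_coef subrr.
  rewrite coef_over; last by rewrite /s in hj ne; lia.
  rewrite sub0r coef_sum big1 ?oppr0 // => l _.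
  rewrite coef_op; case: ifP => // _; rewrite coef_over // sg.
  rewrite /s in hj ne *; lia.
have [|g' hg'] := IH (c - pop n g); first by rewrite /s in hs; lia.
by exists (g + g'); rewrite popD opprD addrA.
Qed.

(** One direction bounds the witness by [size_pop_inv]. In the other, c is replaced by its remainder
    from [pop_reduce]; [op_pop] carries the hypothesis over to the remainder. *)
Lemma socle_poly_fiber : socle_poly <-> fiber_socle.
Proof.
split=> hs n c.
  move=> hc h; have [i id|g e] := hs n c.
    by have [g _ e] := h i id; exists g.
  by exists g => //; apply: size_pop_inv; rewrite -e.
move=> h; have [g0 hg0] := pop_reduce n c.
have [//|i id|g _ e] := hs n (c - pop n g0); last first.
  by exists (g + g0); rewrite popD -e subrK.
have [g e] := h i id; exists (g - op n i g0); last by rewrite popB opB e op_pop.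
by apply: size_pop_inv; rewrite popB -op_pop // -e -opB; apply: size_op.
Qed.

(** The image of [genP] in k[x,y]/(y) = k[x]: only the generators free of y survive. *)
Definition genP_modY : {poly k} :=
  \sum_(0 <= i < d.+1) (if b i == 0%N then 'X^(d - i) else 0).
Notation Q := genP_modY.

Lemma bottom0_gen i z :
  bottom 0 (gen i * z) = (if b i == 0%N then 'X^(d - i) else 0) * bottom 0 z.
Proof.
apply/polyP => u; rewrite coef_bottom cfMmono //= leqn0 andbC.
by case: eqP => _ /=; rewrite ?mul0r ?coef0 // coefXnM coef_bottom sub0n ltnNge; case: leqP.
Qed.

Lemma bottom0_genP z : bottom 0 (genP * z) = Q * bottom 0 z.
Proof.
by rewrite mulr_suml bottom_sum mulr_suml; apply: eq_bigr => i _; rewrite bottom0_gen.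
Qed.

Lemma coef_genP_modY i : (i <= d)%N -> b i = 0%N -> Q`_(d - i) = 1.
Proof.
move=> id bi; rewrite coef_sum (bigD1_seq i) ?iota_uniq ?mem_index_iota //=.
rewrite bi eqxx coefXn eqxx big_nat_cond big1 ?addr0 // => j /andP [jd ji].
case: ifP => _; rewrite ?coef0 // coefXn; case: eqP => //; lia.
Qed.

Lemma genP_modY_neq0 : Q != 0.
Proof.
apply/eqP => Q0; have := @coef_genP_modY 0 (leq0n _) b0.
by rewrite Q0 coef0 => /esym/eqP; rewrite oner_eq0.
Qed.

(** Modulo y, [genP] is a nonzero element of the domain k[x], so y must divide z. *)
Lemma y_dvd_genP w z : Y * w = genP * z -> exists2 t, z = Y * t & w = genP * t.
Proof.
move=> e; have := congr1 (bottom 0) e; rewrite bottom_Y // bottom0_genP => /esym/eqP.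
rewrite mulf_eq0 (negPf genP_modY_neq0) => /eqP /(bottom_eq0 (@inI0 _ _ _ _ _ _)) [t _ zt].
exists t => //; have Y0 : Y != 0.
  by apply/eqP => /(congr1 (fun w => cf w 0 1)) /eqP; rewrite cf_mono // cf0 oner_eq0.
by apply: (mulfI Y0); rewrite e zt mulrCA.
Qed.

(* Modulo y, the sum of the generators is X^e * theta with theta prime to X,
   and bottom 0 w is divisible by X^e as soon as w lies in the ideal. *)
Lemma modYP0 w : inI 1 w -> modYP 2 (gen 0 * w) -> modYP 0 w.
Proof.
move=> hw [x [y [_ _ e]]].
have ex : exists s, Q`_s != 0 by exists (d - 0)%N; rewrite coef_genP_modY ?oner_eq0.
(* This s is the exponent e, the order of vanishing of Q at 0. *)
case: (ex_minnP ex) => s Qs hmin.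
have Qtake : take_poly s Q = 0.
  apply/polyP => j; rewrite coef_take_poly coef0; case: ltnP => // js.
  by apply/eqP; apply: contraLR js => /hmin; rewrite -leqNgt.
pose th := drop_poly s Q; pose w1 := drop_poly s (bottom 0 w).
have Qe : Q = th * 'X^s by rewrite -[LHS](poly_take_drop s) Qtake add0r.
have we : bottom 0 w = w1 * 'X^s.
  rewrite -[LHS](poly_take_drop s); rewrite -[RHS]add0r; congr (_ + _).
  apply/polyP => u; rewrite coef_take_poly coef0 coef_bottom; case: ltnP => // us.
  (* A power x^u in I is divisible by some generator x^(d-i) free of y, and all of these have d - i
     >= s. *)
  apply: hw; rewrite lt0n; apply: contraL us => /eqP h1.
  have [i [hi]] := height_attain d b 0 u; rewrite h1 addn0 => /esym bi.
  have id : (i <= d)%N by rewrite -ltnS.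
  by rewrite -leqNgt; apply: leq_trans hi; apply: hmin; rewrite coef_genP_modY ?oner_eq0.
(* The constant term of [th] is the coefficient of X^s in Q, which is nonzero. *)
have copr : coprimep th 'X.
  by rewrite coprimepX /root horner_coef0 coef_drop_poly.
have : th %| w1.
  rewrite -(@Gauss_dvdpr _ _ 'X^d); last exact: coprimep_expr.
  have h2 : 'X^d * bottom 0 w = Q * bottom 0 y.
    have := congr1 (bottom 0) e; rewrite bottomD bottom_Y // add0r bottom0_genP.
    by rewrite bottom0_gen b0 eqxx subn0.
  have : 'X^d * w1 * 'X^s = th * bottom 0 y * 'X^s.
    by rewrite -mulrA -we h2 Qe mulrAC.
  move=> /mulIf -> ; last by rewrite -size_poly_gt0 size_polyXn.
  exact: dvdp_mulr.
move=> /dvdpP [q w1e].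
have [//||x' _ e'] := @bottom_eq0 0 (w - genP * lift 0 q).
  by rewrite bottomB bottom0_genP bottom_lift we w1e Qe; ring.
by exists x', (lift 0 q); split=> //; rewrite -e' subrK.
Qed.
End InitialForms.

(** * Exchanging t^-1 and y in the extended Rees algebra *)

Section Exchange.
Variables (k : fieldType) (ix iy : 'I_2).
Hypothesis ixy : ix != iy.
Variables (d : nat) (b : nat -> nat).
Hypothesis b0 : b 0 = 0%N.
Notation A := {mpoly k[2]}.
Notation Phi := (height d b).
Notation cf := (cf ix iy).
Notation mono := (mono k ix iy).
Notation gen := (generator k ix iy d b).
Notation inI := (inI ix iy d b).
Notation genP := (genP k ix iy d b).
Notation modYP := (@modYP k ix iy d b).
Notation Y := (mono 0 1).

Definition colon_height := forall m u v,
  (forall i, (i <= d)%N -> (height d b m.+1 (u + (d - i)) <= v + b i)%N) ->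
  (height d b m u <= v)%N.

Lemma inI_monoE n u v : inI n (mono u v) -> (Phi n u <= v)%N.
Proof.
move=> h; rewrite leqNgt; apply/negP => /h /eqP.
by rewrite cf_mono // !eqxx oner_eq0.
Qed.

(** Colons of monomial ideals are monomial, so testing monomials suffices. *)
Lemma colon_closedE : colon_closed k ix iy d b <-> colon_height.
Proof.
split=> [h m u v hi|h m w hw u v uv].
  apply/inI_monoE/h => i id; rewrite monoM //; apply: inI_mono => //.
  by rewrite addnC [(b i + v)%N]addnC; apply: hi.
have [i hi] : exists i : 'I_d.+1, (v + b i < Phi m.+1 (u + (d - i)))%N.
  apply/existsP; apply: contraLR uv => /existsPn hn; rewrite -leqNgt.
  apply: h => i id; have := hn (Ordinal (id : (i < d.+1)%N)).
  by rewrite -leqNgt.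
have id : (i <= d)%N by rewrite -ltnS.
by have := hw i id _ _ hi; rewrite cfMmono // !leq_addl !addnK.
Qed.

(* Vanishing of the class of w in gr/p in degree n.  The truncated predecessor is
   harmless at n = 0, since multiples of genP lie in I. *)
Definition modP (n : nat) (w : A) : Prop :=
  exists x y, [/\ inI n.+1 x, inI n.-1 y & w = x + genP * y].

Definition socle_modP := forall n w, inI n w ->
  (forall i, (i <= d)%N -> modP n.+1 (gen i * w)) -> modP n w.

Hypothesis genPc : forall m w, inI m.+1 (genP * w) -> inI m w.

Lemma genP_pred n w : inI n (genP * w) -> inI n.-1 w.
Proof. by case: n => [|n] //; apply: genPc. Qed.

(* Exchange of t^-1 and y: y w = w' + p h matches the class of w modulo (t^-1, p)
   with that of w' modulo (y, p). *)
Lemma socle_modP_modYP : socle_modP -> socle_modY k ix iy d b.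
Proof.
move=> hs n w hw hi.
(* The expression w = y v + p h is improved level by level: at level l, v lies in I^l. Level 0 is
   [modYP0]. *)
suff h l : (l <= n.+1)%N -> modYP l w by apply: h.
elim: l => [|l IH] ln.
  apply: modYP0 => //; first by apply: inI_le hw.
  have [x [y [hx hy e]]] := hi 0 (leq0n _).
  by exists x, y; split=> //; [apply: inI_le hx|apply: inI_le hy].
have [v [h [hv hh e]]] := IH (ltnW ln).
have genh i : (i <= d)%N -> inI l (gen i * h).
  by move=> id; apply: inI_le (inI_genM ixy id hh); lia.
(* The coefficient v is a socle class of gr/p: two expressions for f_i w are compared and the factor
   y is removed by [y_dvd_genP]. *)
have [|x [y [hx hy ev]]] := hs l v hv.
  move=> i id; have [x [y [hx hy ei]]] := hi i id.
  have [|t yt xt] := @y_dvd_genP k ix iy ixy d b b0 (gen i * v - x) (y - gen i * h).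
    have -> : Y * (gen i * v - x) = gen i * (w - genP * h) - Y * x by rewrite e; ring.
    by rewrite mulrBr ei; ring.
  exists x, t; split; [by apply: inI_le hx; lia| |by rewrite -xt addrC subrK].
  apply: genPc; rewrite -xt; apply: inIB; first exact: inI_genM.
  by apply: inI_le hx; lia.
exists x, (Y * y + h); split=> //; last by rewrite e ev; ring.
apply: genPc; have -> : genP * (Y * y + h) = w - Y * x by rewrite e ev; ring.
by apply: inIB; [apply: inI_le hw|apply: inI_mull].
Qed.

(** The exchange read backwards. If y w = w' + p h, then w' is killed by all f_i t modulo (y, p),
    hence w' = y x + p y'; dividing y (w - x) = p (y' + h) by y shows that w vanishes in gr/p. *)
Lemma socle_modYP_modP_Y : socle_modY k ix iy d b -> forall n w, inI n w ->
  modP n (Y * w) -> (forall i, (i <= d)%N -> modP n.+1 (gen i * w)) -> modP n w.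
Proof.
move=> hs n w hw [w' [h [hw' hh e]]] hi.
have [|x [y [hx hy e']]] := hs n w' hw'.
  move=> i id; have [x [y [hx hy ei]]] := hi i id.
  have e2 : gen i * w' = Y * x + genP * (Y * y - gen i * h).
    by have -> : w' = Y * w - genP * h by [rewrite e; ring]; rewrite mulrBr mulrCA ei; ring.
  exists x, (Y * y - gen i * h); split=> //.
  apply: genPc; have -> : genP * (Y * y - gen i * h) = gen i * w' - Y * x.
    by rewrite e2; ring.
  by apply: inIB; [apply: inI_genM|apply: inI_mull].
have [|t yt xt] := @y_dvd_genP k ix iy ixy d b b0 (w - x) (y + h).
  by rewrite mulrBr e e'; ring.
exists x, t; split=> //; last by rewrite -xt addrC subrK.
by apply: genP_pred; rewrite -xt; apply: inIB => //; apply: inIS.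
Qed.

Lemma modPD n w w' : modP n w -> modP n w' -> modP n (w + w').
Proof.
move=> [x [y [hx hy ->]]] [x' [y' [hx' hy' ->]]]; exists (x + x'), (y + y').
by split; [apply: inID|apply: inID|ring].
Qed.

Lemma modPB n w w' : modP n w -> modP n w' -> modP n (w - w').
Proof.
move=> [x [y [hx hy ->]]] [x' [y' [hx' hy' ->]]]; exists (x - x'), (y - y').
by split; [apply: inIB|apply: inIB|ring].
Qed.

Lemma modP_inI n w : inI n.+1 w -> modP n w.
Proof. by move=> h; exists w, 0; split=> //; [apply: inI00|ring]. Qed.

Lemma modP_inIS n w : modP n w -> inI n w.
Proof.
move=> [x [y [hx hy ->]]]; apply: inID; first exact: inIS.
by case: n {hx} hy => // n hy; apply: inI_genP.
Qed.

Lemma modPM n m w w' : inI n w -> modP m w' -> modP (n + m) (w * w').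
Proof.
move=> hw [x [y [hx hy ->]]]; exists (w * x), (w * y); split; last by ring.
  by rewrite -addnS; apply: inIM.
by apply: inI_le (inIM ixy hw hy); lia.
Qed.

(** Since f_d = y^(b d), the multiple y^(b d) w vanishes in gr; [socle_modYP_modP_Y] then lowers the
    exponent of y one at a time. *)
Lemma socle_modYP_modP : socle_modY k ix iy d b -> socle_modP.
Proof.
move=> hs n w hw hi.
have ge i : (i <= d)%N -> modP n.+1 (gen i * w) by exact: hi.
suff h j t : (t + j = b d)%N -> modP n (mono 0 t * w).
  by have := h (b d) 0%N (add0n _); rewrite mono00 mul1r.
elim: j t => [|j IH] t.
  rewrite addn0 => ->; apply: modP_inI.
  by have := inI_genM ixy (leqnn d) hw; rewrite /generator subnn.
move=> tj; apply: (socle_modYP_modP_Y hs) => [|| i id]; first exact: inI_mull.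
  by rewrite mulrA monoM //; apply: IH; lia.
by rewrite mulrCA; apply: (@modPM 0); [|apply: hi].
Qed.
End Exchange.

(** * The associated graded ring as a quotient of the Rees algebra *)

Section GradedAsPolynomials.
Variables (A : comNzRingType) (J m : A -> Prop).

Lemma Poly_gr_mul (u v : seq A) : Poly (gr_mul u v) = Poly u * Poly v.
Proof.
apply/polyP => n; rewrite coef_Poly coefM; under [RHS]eq_bigr do rewrite !coef_Poly.
case: (ltnP n (size u + size v)) => h; first by rewrite nth_mkseq.
rewrite nth_default ?size_mkseq // big1 // => -[i /= hi] _.
case: (ltnP i (size u)) => hu; last by rewrite nth_default ?mul0r.
by rewrite [X in _ * X]nth_default ?mulr0 //; lia.
Qed.

Lemma Poly_gr_add (u v : seq A) : Poly (gr_add u v) = Poly u + Poly v.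
Proof.
apply/polyP => n; rewrite coefD !coef_Poly.
case: (ltnP n (maxn (size u) (size v))) => h; first by rewrite nth_mkseq.
move: (h); rewrite geq_max => /andP [hu hv].
by rewrite !nth_default ?size_mkseq ?addr0.
Qed.

(** The Rees algebra inside A[t]; gr is its quotient by the ideal [rees1]. This replaces operations
    on sequences by polynomial arithmetic. *)
Definition rees (p : {poly A}) : Prop := forall n, powI J n p`_n.
Definition rees1 (p : {poly A}) : Prop := forall n, powI J n.+1 p`_n.
Definition rees_ideal (us : seq {poly A}) (w : {poly A}) : Prop :=
  exists cs : nat -> {poly A}, (forall i, rees (cs i)) /\
    rees1 (w - \sum_(0 <= i < size us) cs i * us`_i).

Lemma gr_elem_rees u : gr_elem J u <-> rees (Poly u).
Proof. by split=> h n; have := h n; rewrite coef_Poly. Qed.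

Lemma gr_eq_rees1 u v : gr_eq J u v <-> rees1 (Poly u - Poly v).
Proof. by split=> h n; have := h n; rewrite coefB !coef_Poly. Qed.

Lemma Poly_foldr (cs us : seq (seq A)) (s : seq nat) :
  Poly (foldr (@gr_add A) [::] [seq gr_mul (nth [::] cs i) (nth [::] us i) | i <- s]) =
  \sum_(i <- s) Poly (nth [::] cs i) * Poly (nth [::] us i).
Proof.
elim: s => [|i s IH] /=; first by rewrite big_nil.
by rewrite big_cons Poly_gr_add IH Poly_gr_mul.
Qed.

Lemma nth_map_Poly (us : seq (seq A)) i : (map (@Poly A) us)`_i = Poly (nth [::] us i).
Proof.
case: (ltnP i (size us)) => h; first by rewrite (nth_map [::]).
by rewrite !nth_default ?size_map.
Qed.

Lemma gr_in_idealE us w :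
  gr_in_ideal J us w <-> rees_ideal (map (@Poly A) us) (Poly w).
Proof.
split=> [[cs [hs [he hq]]]|[cs [he hq]]].
  exists (fun i => Poly (nth [::] cs i)).
  split; first by move=> i; exact: (proj1 (gr_elem_rees _) (he i)).
  move/gr_eq_rees1: hq; rewrite Poly_foldr size_map /index_iota subn0.
  rewrite (eq_bigr (fun i => Poly (nth [::] cs i) * (map (@Poly A) us)`_i)) // => i _.
  by rewrite nth_map_Poly.
have hnil : gr_elem J [::].
  by move=> [|n]; rewrite nth_nil //; exists [::]; rewrite big_nil.
exists (mkseq (fun i => polyseq (cs i)) (size us)); split; first by rewrite size_mkseq.
split.
  move=> i; case: (ltnP i (size us)) => h; last by rewrite nth_default ?size_mkseq.
  by rewrite nth_mkseq //; apply/gr_elem_rees; rewrite polyseqK.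
apply/gr_eq_rees1; rewrite Poly_foldr; move: hq; rewrite size_map /index_iota subn0.
congr (rees1 (_ - _)); rewrite !big_seq; apply: eq_bigr => i.
by rewrite mem_iota => /andP [_ hi]; rewrite nth_map_Poly nth_mkseq // polyseqK.
Qed.

Definition rees_regular (us : seq {poly A}) : Prop :=
  [/\ forall i, (i < size us)%N -> rees us`_i /\ m (us`_i)`_0,
      forall i, (i < size us)%N -> forall w, rees w ->
        rees_ideal (take i us) (us`_i * w) -> rees_ideal (take i us) w
    & ~ rees_ideal us 1].

Lemma gr_regularE us : gr_regular J m us <-> rees_regular (map (@Poly A) us).
Proof.
have e1 : Poly (gr_one A) = 1 by rewrite /gr_one /= cons_poly_def mul0r add0r.
split=> -[h1 h2 h3]; split.
- move=> i; rewrite size_map => /h1 [he hm].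
  by rewrite nth_map_Poly coef_Poly; split=> //; exact: (proj1 (gr_elem_rees _) he).
- move=> i; rewrite size_map => hi w hw; rewrite nth_map_Poly -map_take => hr.
  rewrite -(polyseqK w); apply/gr_in_idealE/h2 => //.
  by apply/gr_in_idealE; rewrite Poly_gr_mul polyseqK.
- by rewrite -e1 => /gr_in_idealE.
- move=> i hi; have := h1 i; rewrite size_map nth_map_Poly coef_Poly => /(_ hi) [he hm].
  by split=> //; exact: (proj2 (gr_elem_rees _) he).
- move=> i hi w hw /gr_in_idealE; rewrite Poly_gr_mul => hr.
  apply/gr_in_idealE; rewrite map_take; apply: h2; rewrite ?size_map //.
    exact: (proj1 (gr_elem_rees _) hw).
  by rewrite nth_map_Poly -map_take.
- by move=> /gr_in_idealE; rewrite e1.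
Qed.

Lemma gr_depth_geE r :
  gr_depth_ge J m r <-> exists us : seq {poly A}, size us = r /\ rees_regular us.
Proof.
split=> [[us [<- /gr_regularE h]]|[us [<- h]]].
  by exists (map (@Poly A) us); rewrite size_map.
exists (map (@polyseq A) us); rewrite size_map; split=> //.
apply/gr_regularE; rewrite -map_comp (@eq_map _ _ _ id) ?map_id //.
by move=> p /=; rewrite polyseqK.
Qed.
End GradedAsPolynomials.

(** * Elements of the maximal ideal acting on socle classes *)

Section Depth.
Variables (k : fieldType) (ix iy : 'I_2).
Hypothesis ixy : ix != iy.
Variables (d : nat) (b : nat -> nat).
Notation A := {mpoly k[2]}.
Notation Phi := (height d b).
Notation cf := (cf ix iy).
Notation mono := (mono k ix iy).
Notation gen := (generator k ix iy d b).
Notation inI := (inI ix iy d b).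
Notation genP := (genP k ix iy d b).
Notation J := (ideal_of (gens k ix iy d b)).
Variable m : A -> Prop.
Hypothesis mP : forall f, m f -> exists s t, f = s * mono 1 0 + t * mono 0 1.

Definition inS (p : {poly A}) : Prop := forall n, inI n p`_n.
Definition inN (p : {poly A}) : Prop := forall n, inI n.+1 p`_n.

Lemma reesE p : rees J p <-> inS p.
Proof. by split=> h n; apply/(powI_gens ixy)/h. Qed.
Lemma rees1E p : rees1 J p <-> inN p.
Proof. by split=> h n; apply/(powI_gens ixy)/h. Qed.

Lemma inS0 : inS 0. Proof. by move=> n; rewrite coef0; apply: inI00. Qed.
Lemma inSD p q : inS p -> inS q -> inS (p + q).
Proof. by move=> hp hq n; rewrite coefD; apply: inID. Qed.
Lemma inSB p q : inS p -> inS q -> inS (p - q).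
Proof. by move=> hp hq n; rewrite coefB; apply: inIB. Qed.
Lemma inSM p q : inS p -> inS q -> inS (p * q).
Proof.
move=> hp hq n; rewrite coefM; apply: inI_sum => -[i /= hi] _.
by rewrite -{1}(@subnKC i n) //; apply: inIM.
Qed.
Lemma inN0 : inN 0. Proof. by move=> n; rewrite coef0; apply: inI00. Qed.
Lemma inND p q : inN p -> inN q -> inN (p + q).
Proof. by move=> hp hq n; rewrite coefD; apply: inID. Qed.
Lemma inNB p q : inN p -> inN q -> inN (p - q).
Proof. by move=> hp hq n; rewrite coefB; apply: inIB. Qed.
Lemma inNM p q : inS p -> inN q -> inN (p * q).
Proof.
move=> hp hq n; rewrite coefM; apply: inI_sum => -[i /= hi] _.
by rewrite -{1}(@subnKC i n) // -addnS; apply: inIM.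
Qed.
Lemma inS_monom n w : inI n w -> inS (w%:P * 'X^n).
Proof.
move=> h i; rewrite coefCM coefXn; case: eqP => [->|_].
  by rewrite mulr1.
by rewrite mulr0; apply: inI00.
Qed.
Lemma inN_monom n w : inI n.+1 w -> inN (w%:P * 'X^n).
Proof.
move=> h i; rewrite coefCM coefXn; case: eqP => [->|_].
  by rewrite mulr1.
by rewrite mulr0; apply: inI00.
Qed.
Lemma inN_monomE n w : inN (w%:P * 'X^n) -> inI n.+1 w.
Proof. by move=> /(_ n); rewrite coefCM coefXn eqxx mulr1. Qed.

Lemma rees_ideal_nil w : rees_ideal J [::] w <-> inN w.
Proof.
split=> [[cs [_ /rees1E]]|h]; first by rewrite big_nil subr0.
by exists (fun=> 0); split=> [i|]; [apply/reesE/inS0|apply/rees1E; rewrite big_nil subr0].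
Qed.

Lemma rees_ideal_1 g w : rees_ideal J [:: g] w <-> exists2 c, inS c & inN (w - c * g).
Proof.
split=> [[cs [hc /rees1E]]|[c hc hn]].
  by rewrite big_nat1 => h; exists (cs 0) => //; apply/reesE.
by exists (fun=> c); split=> [i|]; [apply/reesE|apply/rees1E; rewrite big_nat1].
Qed.

Lemma inI_span (Q : A -> Prop) n w : Q 0 -> (forall x y, Q x -> Q y -> Q (x + y)) ->
  (forall i a, (i <= d)%N -> inI n a -> Q (gen i * a)) -> inI n.+1 w -> Q w.
Proof.
move=> Q0 QD Qg hw; pattern w; apply: (mono_ind ixy (w := w)) => // u v nz.
have : (Phi n.+1 u <= v)%N by rewrite leqNgt; apply: contra nz => /hw ->.
have [i [iu ->]] := height_attain d b n u => hv.
have id : (i <= d)%N by rewrite -ltnS.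
have -> : cf w u v *: mono u v = gen i * (cf w u v *: mono (u - (d - i)) (v - b i)).
  by rewrite -scalerAr monoM //; congr (_ *: mono _ _); lia.
by apply: Qg => //; apply/inIZ/inI_mono; lia.
Qed.

Section Socle.
Variable K : nat -> A -> Prop.
Hypothesis K0 : forall n, K n 0.
Hypothesis KD : forall n x y, K n x -> K n y -> K n (x + y).
Hypothesis KM : forall n l x y, inI n x -> K l y -> K (n + l) (x * y).
Hypothesis KI : forall n x, inI n.+1 x -> K n x.

(** The component g_0 lies in (x, y), and for l > 0 the component g_l is a combination of the f_i
    with coefficients in I^(l-1). So a class killed by x, y and all f_i t is killed by the whole
    maximal ideal. Here K is vanishing in gr or in gr/p. *)
Lemma socle_mul n w (g : {poly A}) : inS g -> m g`_0 ->
  K n (mono 1 0 * w) -> K n (mono 0 1 * w) ->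
  (forall i, (i <= d)%N -> K n.+1 (gen i * w)) -> forall l, K (l + n) (g`_l * w).
Proof.
move=> hg /mP [s [t e]] hx hy hi [|l].
  by rewrite e mulrDl -!mulrA; apply: KD; apply: (@KM 0).
apply: (@inI_span (fun a => K (l.+1 + n) (a * w)) l) => //.
- by rewrite mul0r.
- by move=> x y hx' hy'; rewrite mulrDl; apply: KD.
move=> i a id ha; rewrite mulrAC mulrC addSnnS.
by apply: KM => //; apply: hi.
Qed.

Hypothesis b0 : b 0 = 0%N.

(** Both x^d = f_0 and y^(b d) = f_d lie in I, so only finitely many multiples x^s y^t w can be
    nonzero. Starting from the largest exponents, each multiple becomes a true socle class and
    vanishes; hence annihilation by x and y need not be assumed. *)
Lemma socle_strong :
  (forall n w, inI n w -> K n (mono 1 0 * w) -> K n (mono 0 1 * w) ->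
    (forall i, (i <= d)%N -> K n.+1 (gen i * w)) -> K n w) ->
  forall n w, inI n w -> (forall i, (i <= d)%N -> K n.+1 (gen i * w)) -> K n w.
Proof.
move=> hs n w hw hi.
suff h j s t : ((d - s) + (b d - t) <= j)%N -> K n (mono s t * w).
  by have := h _ 0%N 0%N (leqnn _); rewrite mono00 mul1r.
have hd s' t' : (d <= s')%N -> K n (mono s' t' * w).
  move=> h; apply: KI; have -> : mono s' t' = mono (s' - d) t' * gen 0.
    by rewrite /generator monoM // b0; congr (mono _ _); lia.
  by rewrite -mulrA; apply/inI_mull/inI_genM.
have hb s' t' : (b d <= t')%N -> K n (mono s' t' * w).
  move=> h; apply: KI; have -> : mono s' t' = mono s' (t' - b d) * gen d.
    by rewrite /generator monoM //; congr (mono _ _); lia.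
  by rewrite -mulrA; apply/inI_mull/inI_genM.
elim: j s t => [|j IH] s t hj; first by apply: hd; lia.
case: (leqP d s) => [|sd]; first exact: hd.
case: (leqP (b d) t) => [|tb]; first exact: hb.
apply: hs; first exact: inI_mull.
- by rewrite mulrA monoM //; apply: IH; lia.
- by rewrite mulrA monoM //; apply: IH; lia.
by move=> i id; rewrite mulrCA; apply: (@KM 0) => //; apply: hi.
Qed.
End Socle.
Hypothesis bd_gt0 : (0 < b d)%N.

Lemma height10 : (0 < Phi 1 0)%N.
Proof.
have [i [hi ->]] := height_attain d b 0 0.
have e : nat_of_ord i = d by move: (ltn_ord i); lia.
by rewrite e ltn_addr.
Qed.

(** In degree 0 neither I nor the maximal ideal has a constant term. This yields properness of the
    ideal and starts the independence argument over k. *)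
Lemma const_rees_ideal (us : seq {poly A}) (c : k) :
  (forall i, (i < size us)%N -> m (us`_i)`_0) ->
  rees_ideal J us ((c%:MP)%:P) -> c = 0.
Proof.
move=> hm [cs [_ /rees1E /(_ 0%N)]]; rewrite coefB coefC eqxx => /(_ _ _ height10).
rewrite cfB coef_sum cf_sum big_nat big1 => [|i hi].
  rewrite subr0 => <-; rewrite -(mulr1 c%:MP) mul_mpolyC cfZ -(mono00 k ix iy) cf_mono //.
  by rewrite mulr1.
rewrite coefM big_ord1 subn0; have [s [t ->]] := mP (hm i hi).
by rewrite mulrDr !mulrA cfD ![_ * mono _ _]mulrC !cfMmono // addr0.
Qed.

End Depth.

(** * Regular elements and socles in depth one and two *)

Section DepthOneTwo.
Variables (k : fieldType) (ix iy : 'I_2).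
Hypothesis ixy : ix != iy.
Variables (d : nat) (b : nat -> nat).
Hypothesis b0 : b 0 = 0%N.
Notation A := {mpoly k[2]}.
Notation mono := (mono k ix iy).
Notation gen := (generator k ix iy d b).
Notation inI := (inI ix iy d b).
Notation genP := (genP k ix iy d b).
Notation J := (ideal_of (gens k ix iy d b)).
Notation modP := (@modP k ix iy d b).
Variable m : A -> Prop.
Hypothesis mP : forall f, m f -> exists s t, f = s * mono 1 0 + t * mono 0 1.
Notation inS := (@inS k ix iy d b).
Notation inN := (@inN k ix iy d b).

Lemma coef_mul_monom (g : {poly A}) w n j :
  (g * (w%:P * 'X^n))`_j = if (j < n)%N then 0 else g`_(j - n) * w.
Proof. by rewrite mulrA coefMXn; case: ifP => // _; rewrite coefMC. Qed.

(** A class killed by x, y and all f_i t is killed by g and therefore zero; [socle_strong] removes x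
    and y. *)
Lemma regular_colon (g : {poly A}) : inS g -> m g`_0 ->
  (forall w, inS w -> inN (g * w) -> inN w) -> colon_closed k ix iy d b.
Proof.
move=> hg hm hreg.
have KD n (x y : A) : inI n.+1 x -> inI n.+1 y -> inI n.+1 (x + y) by exact: inID.
have KM n l (x y : A) : inI n x -> inI l.+1 y -> inI (n + l).+1 (x * y).
  by rewrite -addnS; apply: inIM.
have strong := @socle_strong k ix iy ixy d b (fun n => inI n.+1) KM (fun _ _ => id) b0.
have {}strong n w : inI n w -> (forall i, (i <= d)%N -> inI n.+2 (gen i * w)) -> inI n.+1 w.
  apply: strong => n' x hx h1 h2 h3.
  have hS := inS_monom hx; apply/inN_monomE/hreg => // j.
  rewrite coef_mul_monom; case: ltnP => h; first exact: inI00.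
  rewrite -{1}(subnK h).
  by apply: (@socle_mul k ix iy ixy d b m mP (fun n => inI n.+1)) => // n1; apply: inI00.
(* Nothing is known about w beyond w in A = I^0, so it is moved up one power of I at a time. *)
move=> n w hw; suff h l : (l <= n)%N -> inI l w by apply: h.
elim: l => [|l IH] // ln; apply: strong; first exact/IH/ltnW.
by move=> i id; apply: inI_le (hw i id).
Qed.

Definition pol : {poly A} := genP%:P * 'X.

Lemma coef_pol h n : (pol * h)`_n = if n is n'.+1 then genP * h`_n' else 0.
Proof. by rewrite /pol -mulrA coefCM coefXM; case: n => [|n] //=; rewrite mulr0. Qed.

Lemma inS_pol : inS pol.
Proof.
move=> n; rewrite coefCM coefX; case: n => [|[|n]] //=; rewrite ?mulr0 ?mulr1;
  try exact: inI00.
by rewrite -[genP]mulr1; apply: inI_genP.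
Qed.

Definition inP (f : {poly A}) : Prop := forall n, modP n f`_n.

Lemma inPD f g : inP f -> inP g -> inP (f + g).
Proof. by move=> hf hg n; rewrite coefD; apply: modPD. Qed.
Lemma inPB f g : inP f -> inP g -> inP (f - g).
Proof. by move=> hf hg n; rewrite coefB; apply: modPB. Qed.
Lemma modP0 n : modP n 0. Proof. exact/modP_inI/inI00. Qed.
Lemma inPM f g : inS f -> inP g -> inP (f * g).
Proof.
move=> hf hg n; rewrite coefM; elim/big_ind: _ => [|x y|[i /= hi] _].
- exact: modP0.
- exact: modPD.
by rewrite -{1}(@subnKC i n) //; apply: modPM.
Qed.
Lemma inP_intro f h : inS h -> inN (f - h * pol) -> inP f.
Proof.
move=> hS hN n; exists ((f - h * pol)`_n).
rewrite coefB mulrC coef_pol; case: n => [|n].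
  exists 0; split=> //; last by ring.
  by have := hN 0%N; rewrite coefB mulrC coef_pol.
exists h`_n; split; [|exact: hS|by ring].
by have := hN n.+1; rewrite coefB mulrC coef_pol.
Qed.

(** As p is homogeneous, membership in its ideal can be tested degree by degree, and the cofactors
    found in each degree are added up. *)
Lemma inP_elim f : inP f -> exists2 h, inS h & inN (f - h * pol).
Proof.
move=> hf; rewrite -(coefK f) poly_def.
elim/big_ind: _ => [|x y [x' hx nx] [y' hy ny]|[i _] _ /=].
- by exists 0; [apply: inS0|rewrite mul0r subr0; apply: inN0].
- exists (x' + y'); first exact: inSD.
  have -> : x + y - (x' + y') * pol = (x - x' * pol) + (y - y' * pol) by ring.
  exact: inND.
rewrite -mul_polyC; have [x [y [hx hy ->]]] := hf i.
case: i hx hy => [|i] hx hy.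
  exists 0; first exact: inS0.
  rewrite mul0r subr0; apply: inN_monom; apply: inID => //.
  by apply: inI_genP.
exists (y%:P * 'X^i); first exact: inS_monom.
have -> : (x + genP * y)%:P * 'X^(i.+1) - y%:P * 'X^i * pol = x%:P * 'X^(i.+1).
  by rewrite /pol polyCD polyCM exprSr; ring.
exact: inN_monom.
Qed.

Hypothesis genPc : forall n w, inI n.+1 (genP * w) -> inI n w.

Lemma pol_cancel f : inN (pol * f) -> inN f.
Proof. by move=> h n; have := h n.+1; rewrite coef_pol; apply: genPc. Qed.

(** A socle class W of gr/p gives g1 W = h1 p and g2 W = h2 p. Cancelling p yields g2 h1 = h2 g1, so
    h1 = c g1 by regularity of g2 modulo g1; cancelling g1 then gives W = c p. *)
Lemma regular2_socle (g1 g2 : {poly A}) : inS g1 -> m g1`_0 -> inS g2 -> m g2`_0 ->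
  (forall w, inS w -> inN (g1 * w) -> inN w) ->
  (forall w, inS w -> (exists2 c, inS c & inN (g2 * w - c * g1)) ->
    exists2 c, inS c & inN (w - c * g1)) ->
  socle_modP k ix iy d b.
Proof.
move=> S1 m1 S2 m2 reg1 reg2.
have KM n l (x y : A) : inI n x -> modP l y -> modP (n + l) (x * y) by exact: modPM.
apply: (@socle_strong k ix iy ixy d b modP) => // [n x|n w hw hx hy hi].
  exact: modP_inI.
pose W := w%:P * 'X^n; have SW : inS W by exact: inS_monom.
have mulW g : inS g -> m g`_0 -> exists2 h, inS h & inN (g * W - h * pol).
  move=> Sg mg; apply: inP_elim => j; rewrite coef_mul_monom.
  case: ltnP => h; first exact: modP0.
  rewrite -{1}(subnK h); apply: (@socle_mul k ix iy ixy d b m mP modP) => //.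
  - exact: modP0.
  - by move=> n0 x y; apply: modPD.
have [h1 Sh1 N1] := mulW g1 S1 m1; have [h2 Sh2 N2] := mulW g2 S2 m2.
have [||c Sc Nc] := reg2 h1 => //.
  exists h2 => //; apply: pol_cancel.
  have -> : pol * (g2 * h1 - h2 * g1) = g1 * (g2 * W - h2 * pol) - g2 * (g1 * W - h1 * pol).
    by ring.
  by apply: inNB; apply: inNM.
have : inN (W - c * pol).
  apply: reg1; first by apply: inSB => //; apply: inSM => //; apply: inS_pol.
  have -> : g1 * (W - c * pol) = (g1 * W - h1 * pol) + pol * (h1 - c * g1) by ring.
  by apply: inND => //; apply: inNM => //; apply: inS_pol.
move=> /(inP_intro Sc) /(_ n).
by rewrite coefCM coefXn eqxx mulr1.
Qed.

Hypothesis soc : socle_modP k ix iy d b.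

(* The exponents are lowered to 1 one generator at a time. *)
Lemma socle_powers t n w : inI n w ->
  (forall i, (i < t)%N -> (i <= d)%N -> modP n.+1 (gen i * w)) ->
  (forall i, (t <= i)%N -> (i <= d)%N -> modP (n + i.+1) (gen i ^+ i.+1 * w)) -> modP n w.
Proof.
have [j] := ubnP (d.+1 - t); elim: j t n w => // j IH t n w hj hw hlt hge.
case: (ltnP d t) => td; first by apply: soc => // i id; apply: hlt => //; lia.
have genX s : inI (n + s) (gen t ^+ s * w).
  elim: s => [|s IHs]; first by rewrite addn0 mul1r.
  by rewrite exprS -mulrA addnS; apply: inI_genM.
suff h s r : (s + r = t.+1)%N -> modP (n + s) (gen t ^+ s * w).
  by have := h 0%N t.+1 (add0n _); rewrite addn0 mul1r.
elim: r s => [|r IHr] s; first by rewrite addn0 => ->; apply: hge.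
move=> sr; apply: (IH t.+1) => //; first lia.
- move=> i; rewrite ltnS leq_eqVlt => /orP [/eqP -> id|it id].
    by rewrite mulrA -exprS -addnS; apply: IHr; lia.
  rewrite mulrCA.
  have -> : (n + s).+1 = (s + n.+1)%N by lia.
  apply: modPM => //; last exact: hlt.
  by elim: (s) => [|s' IHs] //; rewrite exprS; apply: inI_genM.
move=> i it id; rewrite mulrCA.
have -> : (n + s + i.+1 = s + (n + i.+1))%N by lia.
apply: modPM => //; last by apply: hge => //; lia.
by elim: (s) => [|s' IHs] //; rewrite exprS; apply: inI_genM.
Qed.

(** The exponents i+1 give the summands distinct t-degrees, as [cancel_sum] requires; the f_i t
    themselves all have degree one. *)
Definition pol2 : {poly A} := \sum_(0 <= i < d.+1) ((gen i)%:P * 'X) ^+ i.+1.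

Lemma genXE i : ((gen i)%:P * 'X) ^+ i.+1 = (gen i ^+ i.+1)%:P * 'X^(i.+1).
Proof. by rewrite exprMn -polyC_exp. Qed.

Lemma inS_genX i : (i <= d)%N -> inS (((gen i)%:P * 'X) ^+ i.+1).
Proof.
move=> id; rewrite genXE; apply: inS_monom.
by elim: (i.+1) => [|s' IHs] //; rewrite exprS; apply: inI_genM.
Qed.

Lemma inS_pol2 : inS pol2.
Proof.
rewrite /pol2 big_nat; elim/big_ind: _ => [|x y|i hi]; [exact: inS0|exact: inSD|].
by apply: inS_genX; lia.
Qed.

Lemma pol2_regular w : inS w -> inP (pol2 * w) -> inP w.
Proof.
(* The filtration is constant, equal to the ideal (p), so its index is immaterial and set to 0; the
   successor function gives the degrees i+1. *)
move=> hS; apply: (@cancel_sum _ (fun n (f : {poly A}) => (f`_n)%:P * 'X^n) inS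
  (fun _ => inP) d.+1 (fun i => ((gen i)%:P * 'X) ^+ i.+1)
  S _ _ _ _ _ _ _ _ _ _ _ _ _ _ 0) => //.
- by move=> _ n; rewrite coef0; apply: modP0.
- by move=> _; apply: inPD.
- by move=> _; apply: inPB.
- move=> _ n x hx j; rewrite coefCM coefXn; case: eqP => [->|_].
    by rewrite mulr1.
  by rewrite mulr0; apply: modP0.
- by move=> n x y; rewrite coefD polyCD mulrDl.
- by move=> n; rewrite coef0 mul0r.
- by move=> _ x _ hx n; have := hx n n; rewrite coefCM coefXn eqxx mulr1.
- move=> x; exists (size x) => n hn.
  by rewrite [x`_n]nth_default // mul0r.
- by move=> i x ir hx; apply: inSM => //; apply: inS_genX.
- by move=> i _ x ir hx; apply: inPM => //; apply: inS_genX.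
- move=> i n x ir; rewrite genXE -mulrA coefCM coefXnM ltnNge leq_addl /= addnK.
  by rewrite polyCM exprD; ring.
- by move=> i n x ir ni; rewrite genXE -mulrA coefCM coefXnM ni mulr0 mul0r.
move=> _ n x hx h j; rewrite coefCM coefXn; case: eqP => [->|_]; last first.
  by rewrite mulr0; apply: modP0.
rewrite mulr1; apply: (@socle_powers 0) => // i _ id.
have := h i id (n + i.+1)%N; rewrite genXE.
by rewrite coef_mul_monom ltnNge leq_addr /= addKn coefCM coefXn eqxx mulr1.
Qed.
End DepthOneTwo.

(** * No regular sequence of length three: growth of gr *)

Section Growth.
Variables (k : fieldType) (ix iy : 'I_2).
Hypothesis ixy : ix != iy.
Variables (d : nat) (b : nat -> nat).
Hypotheses (b0 : b 0 = 0%N) (bd_gt0 : (0 < b d)%N).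
Notation A := {mpoly k[2]}.
Notation Phi := (height d b).
Notation cf := (cf ix iy).
Notation mono := (mono k ix iy).
Notation gen := (generator k ix iy d b).
Notation inI := (inI ix iy d b).
Notation J := (ideal_of (gens k ix iy d b)).
Variable m : A -> Prop.
Hypothesis mP : forall f, m f -> exists s t, f = s * mono 1 0 + t * mono 0 1.
Notation inS := (@inS k ix iy d b).
Notation inN := (@inN k ix iy d b).
Notation const c := ((c%:MP)%:P : {poly A}).

(** The constant term of a relation in powers of g lies in I + (g), here [Ig], hence vanishes; the
    rest is divisible by g, which is cancelled, and the argument repeats. *)
Lemma regular_expansion (I Ig : {poly A} -> Prop) g (Q : nat -> Prop) M w :
  (forall f, inS f -> I (g * f) -> I f) ->
  (forall f h, inS h -> I (f + g * h) -> Ig f) ->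
  inS g -> (forall a, inS (w a)) ->
  (forall a, (a < M)%N -> Ig (w a) -> Q a) -> (forall a, Q a -> w a = 0) ->
  I (\sum_(0 <= a < M) g ^+ a * w a) -> forall a, (a < M)%N -> Q a.
Proof.
move=> reg hIg Sg; elim: M Q w => // M IH Q w Sw hQ hQ0.
rewrite big_nat_recl // mul1r.
under eq_bigr do rewrite exprS -mulrA.
rewrite -mulr_sumr => hI.
have SX a : inS (g ^+ a).
  elim: a => [|a IHa]; last by rewrite exprS; apply: inSM.
  by move=> n; rewrite coef1; case: n => [|n]; [apply: inI0|apply: inI00].
have Ss : inS (\sum_(0 <= i < M) g ^+ i * w i.+1).
  by elim/big_ind: _ => [|x y|i _]; [apply: inS0|apply: inSD|apply: inSM].
have Q0 : Q 0%N by apply: hQ => //; apply: hIg hI.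
rewrite hQ0 // add0r in hI; move/(reg _ Ss): hI => hI.
case=> // a aM; apply: (IH (fun a => Q a.+1) (fun a => w a.+1)) => //.
- by move=> a' ha'; apply: hQ.
- by move=> a'; apply: hQ0.
Qed.

Lemma rees_ideal_rcons us g f h : inS h ->
  rees_ideal J us (f + g * h) -> rees_ideal J (rcons us g) f.
Proof.
move=> hh [cs [hc hn]].
exists (fun i => if i == size us then - h else cs i); split=> [i|].
  case: ifP => _ //; apply/(reesE ixy); rewrite -sub0r; apply: inSB => //; exact: inS0.
rewrite size_rcons big_nat_recr //= eqxx nth_rcons ltnn eqxx.
rewrite (eq_big_nat _ _ (F2 := fun i => cs i * us`_i)) => [|i /andP [_ hi]].
  by move: hn; congr (rees1 _ _); ring.
by rewrite nth_rcons hi; case: eqP => // e; move: hi; rewrite e ltnn.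
Qed.

(** Three nested uses of [regular_expansion], one for each element; the innermost coefficients are
    scalars, settled by [const_rees_ideal]. *)
Lemma regular3_independent (us : seq {poly A}) (M : nat) (la : nat -> nat -> nat -> k) :
  (2 < size us)%N -> rees_regular J m us ->
  inN (\sum_(0 <= a1 < M) us`_0 ^+ a1 * \sum_(0 <= a2 < M) us`_1 ^+ a2 *
        \sum_(0 <= a3 < M) us`_2 ^+ a3 * const (la a1 a2 a3)) ->
  forall a1 a2 a3, (a1 < M)%N -> (a2 < M)%N -> (a3 < M)%N -> la a1 a2 a3 = 0.
Proof.
move=> hsz [hSm hreg _].
have Sc c : inS (const c).
  by move=> n; rewrite coefC; case: eqP => [->|_]; [apply: inI0|apply: inI00].
have Su i : (i < 3)%N -> inS us`_i.
  by move=> hi; apply/(reesE ixy); case: (hSm i (leq_trans hi hsz)).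
have SX i a : (i < 3)%N -> inS (us`_i ^+ a).
  move=> hi; elim: a => [|a IHa]; first by rewrite expr0; apply: (Sc 1).
  by rewrite exprS; apply: inSM => //; apply: Su.
have SSum i M' F : (i < 3)%N -> (forall a, inS (F a)) ->
    inS (\sum_(0 <= a < M') us`_i ^+ a * F a).
  move=> hi hF; elim/big_ind: _ => [|x y|a _]; [exact: inS0|exact: inSD|].
  by apply: inSM => //; apply: SX.
have step i M' (Q : nat -> Prop) w : (i < 3)%N -> (forall a, inS (w a)) ->
    (forall a, (a < M')%N -> rees_ideal J (take i.+1 us) (w a) -> Q a) ->
    (forall a, Q a -> w a = 0) ->
    rees_ideal J (take i us) (\sum_(0 <= a < M') us`_i ^+ a * w a) ->
    forall a, (a < M')%N -> Q a.
  move=> hi Sw; have hi' : (i < size us)%N by apply: leq_trans hi hsz.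
  apply: (@regular_expansion (rees_ideal J (take i us))) => //; last exact: Su.
    by move=> f hf; apply: hreg => //; apply/(reesE ixy).
  by move=> f h hh; rewrite (take_nth 0) //; apply: rees_ideal_rcons.
move=> hN a1 a2 a3 h1 h2 h3; move: a1 h1 a2 h2 a3 h3.
apply: (@step 0 M
  (fun a1 => forall a2, (a2 < M)%N -> forall a3, (a3 < M)%N -> la a1 a2 a3 = 0)
  (fun a1 => \sum_(0 <= a2 < M) us`_1 ^+ a2 *
        \sum_(0 <= a3 < M) us`_2 ^+ a3 * const (la a1 a2 a3))) => //.
- by move=> a1; apply: (SSum) => // a2; apply: SSum.
- move=> a1 _; apply: (@step 1 M (fun a2 => forall a3, (a3 < M)%N -> la a1 a2 a3 = 0)
    (fun a2 =>
        \sum_(0 <= a3 < M) us`_2 ^+ a3 * const (la a1 a2 a3))) => //.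
  + by move=> a2; apply: SSum.
  + move=> a2 _; apply: (@step 2 M (fun a3 => la a1 a2 a3 = 0)
      (fun a3 => const (la a1 a2 a3))) => //.
    * move=> a3 _; apply: (const_rees_ideal ixy mP bd_gt0) => i; rewrite size_take_min.
      move=> hi; have hi3 : (i < 3)%N by apply: leq_trans hi (geq_minl _ _).
      by rewrite nth_take //; case: (hSm i (leq_trans hi3 hsz)).
    * by move=> a3 ->; rewrite mpolyC0.
  + move=> a2 hz; rewrite big_nat big1 // => a3 /andP [_ h].
    by rewrite hz // mpolyC0 mulr0.
- move=> a1 hz; rewrite big_nat big1 // => a2 /andP [_ h2].
  rewrite big_nat big1 ?mulr0 // => a3 /andP [_ h3].
  by rewrite hz // mpolyC0 mulr0.
by rewrite take0; apply/rees_ideal_nil.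
Qed.

(** In degrees n < K a monomial x^u y^v that is nonzero in gr has u < Kd and v < K b(d), so that
    part of gr has dimension at most (Kd)(K b(d)). *)
Lemma dependence_of_bounded_degree (T : finType) (G : T -> {poly A}) K :
  (forall t, inS (G t)) -> (forall t, size (G t) <= K)%N ->
  ((K * d) * (K * b d) < #|T|)%N ->
  exists2 la : T -> k, (exists t, la t != 0) & inN (\sum_t const (la t) * G t).
Proof.
move=> SG sG hT.
pose U : finType := ('I_(K * d) * 'I_(K * b d))%type.
(* At most one n satisfies the bounds, because heights grow with n; it is the degree in which x^u
   y^v is nonzero in gr. *)
pose ev (u v : nat) (p : {poly A}) : k :=
  \sum_(n < K | (Phi n u <= v < Phi n.+1 u)%N) cf p`_n u v.
pose X : 'M[k]_(#|T|, #|U|) :=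
  \matrix_(i < #|T|, j < #|U|)
     (let x : 'I_(K * d) * 'I_(K * b d) := enum_val j in
      ev x.1 x.2 (G (enum_val i))).
have : kermx X != 0.
  rewrite kermx_eq0 /row_free neq_ltn; apply/orP; left.
  by apply: leq_ltn_trans (rank_leq_col X) _; rewrite card_prod !card_ord.
move=> /rowV0Pn [v /sub_kermxP vX v0].
exists (fun t => v 0 (enum_rank t)).
  have [j hj] : exists j, v 0 j != 0.
    apply/existsP; apply: contraNT v0 => /existsPn h; apply/eqP/rowP => j.
    by rewrite mxE; apply/eqP; have := h j; rewrite negbK.
  by exists (enum_val j); rewrite enum_valK.
move=> n u w uw; rewrite coef_sum cf_sum.
under eq_bigr do rewrite coefCM mul_mpolyC cfZ.
case: (ltnP w (Phi n u)) => h.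
  by apply: big1 => t _; rewrite (SG t n u w h) mulr0.
case: (ltnP n K) => nK; last first.
  by apply: big1 => t _; rewrite [_`_n]nth_default ?cf0 ?mulr0 // (leq_trans (sG t)).
have hu : (u < K * d)%N.
  rewrite ltnNge; apply/negP => hu; move: uw; rewrite height_eq0 //.
  by apply: leq_trans hu; rewrite leq_mul2r nK orbT.
have hw : (w < K * b d)%N.
  apply: leq_trans uw _; apply: leq_trans (height_bound _ _ _ _) _.
  by rewrite leq_mul2r nK orbT.
have := congr1 (fun Y : 'rV_ _ => Y 0 (enum_rank (Ordinal hu, Ordinal hw))) vX.
rewrite !mxE => e0; apply: etrans e0.
rewrite [RHS](reindex_onto enum_rank enum_val) /=; last first.
  by move=> i _; rewrite enum_valK.
rewrite [RHS](eq_bigl xpredT) => [|t]; last by rewrite enum_rankK eqxx.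
apply: eq_bigr => t _; rewrite mxE !enum_rankK /=; congr (_ * _).
rewrite /ev (eq_bigl (pred1 (Ordinal nK))) ?big_pred1_eq // => i /=.
apply/idP/eqP => [/andP [h1 h2]|->]; last by rewrite h uw.
apply/val_inj => /=; apply/eqP; rewrite eqn_leq; apply/andP; split.
  rewrite leqNgt; apply/negP => ni.
  by have := leq_trans uw (height_monotone d b u ni); rewrite ltnNge h1.
rewrite leqNgt; apply/negP => ni.
by have := leq_trans h2 (height_monotone d b u ni); rewrite ltnNge h.
Qed.

Lemma no_regular3 (us : seq {poly A}) : (2 < size us)%N -> ~ rees_regular J m us.
Proof.
move=> hsz hr.
have Su i : (i < 3)%N -> inS us`_i.
  by move=> hi; apply/(reesE ixy); case: hr => [h _ _]; case: (h i (leq_trans hi hsz)).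
pose D := maxn (size us`_0) (maxn (size us`_1) (size us`_2)).
(* This is M = 9 d b(d) (D+1)^2 + 1. With K = 3(DM+1) the dimension bound is at most 9 d b(d)
   (D+1)^2 M^2, which is below M^3, the number of monomials with exponents below M. *)
pose M := (9 * (D * D) * (d * b d) + 9 * (d * b d) * (2 * D + 1) + 1)%N.
pose T : finType := ('I_M * 'I_M * 'I_M)%type.
pose G (t : T) := us`_0 ^+ t.1.1 * us`_1 ^+ t.1.2 * us`_2 ^+ t.2.
have SX i a : (i < 3)%N -> inS (us`_i ^+ a).
  move=> hi; elim: a => [|a IHa].
    by rewrite expr0 => n; rewrite coef1; case: n => [|n]; [apply: inI0|apply: inI00].
  by rewrite exprS; apply: inSM => //; apply: Su.
have sX (p : {poly A}) (a : 'I_M) : (size p <= D)%N -> (size (p ^+ a) <= D * M + 1)%N.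
  move=> hp; apply: leq_trans (size_poly_exp_leq _ _) _.
  rewrite addn1 ltnS; apply: leq_mul; last exact/ltnW/ltn_ord.
  by apply: leq_trans (leq_pred _) hp.
have [|||la [t lat] hN] := @dependence_of_bounded_degree T G (3 * (D * M + 1)).
- by move=> t; apply: inSM => //; [apply: inSM => //|]; apply: (SX).
- move=> t; rewrite /G; apply: leq_trans (size_polyMleq _ _) _.
  have h0 : (size (us`_0)%R <= D)%N by rewrite leq_maxl.
  have h1 : (size (us`_1)%R <= D)%N by rewrite /D; lia.
  have h2 : (size (us`_2)%R <= D)%N by rewrite /D; lia.
  have := size_polyMleq (us`_0 ^+ t.1.1) (us`_1 ^+ t.1.2).
  move: (sX _ t.1.1 h0) (sX _ t.1.2 h1) (sX _ t.2 h2); lia.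
- rewrite !card_prod !card_ord.
  suff : (9 * (d * b d) * ((D * M + 1) * (D * M + 1)) < M * M * M)%N by lia.
  have hM : (9 * (d * b d) * ((D + 1) * (D + 1)) < M)%N by rewrite /M; lia.
  have h1 : ((D * M + 1) * (D * M + 1) <= (D + 1) * (D + 1) * (M * M))%N by nia.
  nia.
case: t lat => -[a1 a2] a3 /negP; apply; apply/eqP.
pose la' x y z := if (insub x, insub y, insub z) is (Some x', Some y', Some z')
  then la ((x', y'), z') else 0.
have := @regular3_independent us M la' hsz hr.
rewrite /la' => /(_ _ a1 a2 a3); rewrite !valK; apply=> //.
move: hN; congr inN.
have -> (F : T -> {poly A}) : \sum_t F t = \sum_x \sum_y \sum_z F ((x, y), z).
  by rewrite !pair_bigA; apply: eq_bigr => -[[x y] z].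
rewrite big_mkord; apply: eq_bigr => x _; rewrite big_mkord mulr_sumr.
apply: eq_bigr => y _; rewrite big_mkord !mulr_sumr; apply: eq_bigr => z _.
by rewrite !valK /G /=; ring.
Qed.
End Growth.

(** * The depth expressed by heights and fiber operators *)

Section DepthCharacterization.
Variables (k : fieldType) (ix iy : 'I_2).
Hypothesis ixy : ix != iy.
Variables (d : nat) (b : nat -> nat).
Hypotheses (b0 : b 0 = 0%N) (bd_gt0 : (0 < b d)%N).
Notation A := {mpoly k[2]}.
Notation mono := (mono k ix iy).
Notation J := (ideal_of (gens k ix iy d b)).
Variable m : A -> Prop.
Hypothesis m0 : m 0.
Hypothesis mP : forall f, m f -> exists s t, f = s * mono 1 0 + t * mono 0 1.

Lemma socle_modP_fiber :
  (forall n w, inI ix iy d b n.+1 (genP k ix iy d b * w) -> inI ix iy d b n w) ->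
  socle_modP k ix iy d b <-> fiber_socle k d b.
Proof.
move=> genPc; split=> h.
  by apply/(socle_poly_fiber _ ixy _ b0)/(socle_modY_poly _ ixy _ b0)/socle_modP_modYP.
apply: socle_modYP_modP => //.
by apply/(socle_modY_poly _ ixy _ b0)/(socle_poly_fiber _ ixy _ b0).
Qed.

Lemma one_notin_rees_ideal (us : seq {poly A}) :
  (forall i, (i < size us)%N -> m (us`_i)`_0) -> ~ rees_ideal J us 1.
Proof.
move=> hm h; have := @const_rees_ideal _ _ _ ixy d b m mP bd_gt0 us 1 hm.
by rewrite mpolyC1 => /(_ h) /eqP; rewrite oner_eq0.
Qed.

Lemma rees_regular_pol : colon_height d b -> rees_regular J m [:: pol k ix iy d b].
Proof.
move=> /(colon_closedE k ixy _ _) /(genP_cancel ixy) genPc.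
have hm i : (i < 1)%N -> m ([:: pol k ix iy d b]`_i)`_0.
  by case: i => // _ /=; rewrite coefCM coefX mulr0.
split; [|move=> [|i] // _ w hw|exact: one_notin_rees_ideal].
  move=> i i1; split; last exact: hm.
  by case: i i1 => // _; apply/reesE/inS_pol.
rewrite take0 => /(rees_ideal_nil ixy) h; apply/rees_ideal_nil => //.
exact: (pol_cancel genPc h).
Qed.

Lemma rees_regular_pol2 : colon_height d b -> fiber_socle k d b ->
  rees_regular J m [:: pol k ix iy d b; pol2 k ix iy d b].
Proof.
move=> hc hf; have [hS1 hr1 _] := rees_regular_pol hc.
move: hc => /(colon_closedE k ixy _ _) /(genP_cancel ixy) genPc.
move: hf => /(socle_modP_fiber genPc) hsoc.
have hm i : (i < 2)%N -> m ([:: pol k ix iy d b; pol2 k ix iy d b]`_i)`_0.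
  case: i => [|[|//]] _ /=; first by rewrite coefCM coefX mulr0.
  rewrite coef_sum big1 // => i _.
  by rewrite genXE coefCM coefXn mulr0.
split; [|move=> [|[|i]] // _ w hw|exact: one_notin_rees_ideal].
- move=> i i2; split; last exact: hm.
  by case: i i2 => [|[|//]] _; apply/reesE => //; [apply: inS_pol|apply: inS_pol2].
- by have := hr1 0%N isT w hw.
move=> /(rees_ideal_1 ixy) [c Sc Nc]; apply/(rees_ideal_1 ixy)/inP_elim => //.
apply: (pol2_regular ixy b0 hsoc); first exact/reesE.
exact: (inP_intro Sc Nc).
Qed.

(** The right-hand side involves the ideal only through the exponents b and the heights, which makes
    the two rings comparable. *)
Theorem gr_depth_ge_iff r : gr_depth_ge J m r <->
  [/\ (r <= 2)%N, (0 < r)%N -> colon_height d b & (1 < r)%N -> fiber_socle k d b].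
Proof.
split=> [/gr_depth_geE [us [<- hus]]|[]].
  have r2 : (size us <= 2)%N.
    by rewrite leqNgt; apply/negP => h; apply: (no_regular3 ixy b0 bd_gt0 mP h hus).
  have colon : (0 < size us)%N -> colon_closed k ix iy d b.
    case: us hus {r2} => // g1 us [hS hr _] _.
    have [/(reesE ixy) S1 m1] := hS 0%N isT.
    apply: (regular_colon ixy b0 mP S1 m1) => w hw hN.
    apply/(rees_ideal_nil ixy); have := hr 0%N isT w.
    rewrite take0; apply; first exact/reesE.
    exact/(rees_ideal_nil ixy).
  split=> // [/colon /(colon_closedE k ixy _ _) //|h1].
  have genPc := genP_cancel ixy (colon (ltnW h1)).
  apply/(socle_modP_fiber genPc).
  case: us hus h1 {r2 colon} => // g1 [] // g2 us [hS hr _] _.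
  have [/(reesE ixy) S1 m1] := hS 0%N isT; have [/(reesE ixy) S2 m2] := hS 1%N isT.
  apply: (regular2_socle ixy b0 mP genPc S1 m1 S2 m2) => w hw hN.
    apply/(rees_ideal_nil ixy); have := hr 0%N isT w.
    rewrite take0; apply; first exact/reesE.
    exact/(rees_ideal_nil ixy).
  apply/(rees_ideal_1 ixy); have := hr 1%N isT w; rewrite /=; apply; first exact/reesE.
  exact/(rees_ideal_1 ixy).
case: r => [|[|[|//]]] _ hc hf; apply/gr_depth_geE.
- by exists [::]; split=> //; split=> //; apply: one_notin_rees_ideal.
- by exists [:: pol k ix iy d b]; split=> //; apply/rees_regular_pol/hc.
exists [:: pol k ix iy d b; pol2 k ix iy d b]; split=> //.
by apply: rees_regular_pol2; [apply: hc|apply: hf].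
Qed.
End DepthCharacterization.

(** * Comparison of L and T(L) *)

Section Comparison.
Variables (d : nat) (a : nat -> nat).
Hypothesis a0 : a 0 = 0%N.
Hypothesis a_incr : forall i, (i < d)%N -> (a i < a i.+1)%N.
Notation b := (fun i => a i - i)%N.

Lemma exponent_ge i : (i <= d)%N -> (i <= a i)%N.
Proof.
elim: i => // i IH id; exact: leq_ltn_trans (IH (ltnW id)) (a_incr id).
Qed.

Lemma shifted_nondecr i j : (i <= j)%N -> (j <= d)%N -> (a i - i <= a j - j)%N.
Proof.
elim: j => [|j IH]; first by rewrite leqn0 => /eqP ->.
rewrite leq_eqVlt => /orP [/eqP -> //|ij] jd.
by apply: leq_trans (IH ij (ltnW jd)) _; have := a_incr jd; lia.
Qed.

(* This is the substitution x = yz: x^u y^v lies in L^n exactly when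
   z^u y^(u+v-nd) lies in T(L)^n. *)
Lemma height_shift n u : height d a n u = (height d b n u + (n * d - u))%N.
Proof.
apply/eqP; rewrite eqn_leq; apply/andP; split; elim: n u => [|n IH] u //.
  case: (leqP (n.+1 * d) u) => h; first by rewrite height_eq0.
  have [i [hi ->]] := height_attain d b n u.
  have id : (i <= d)%N by rewrite -ltnS.
  have ai := exponent_ge id.
  case: (leqP (u - (d - i)) (n * d)) => h'.
    apply: leq_trans (height_le _ _ id hi) _.
    by have := IH (u - (d - i))%N; rewrite mulSn; lia.
  (* The index is lowered to j = (n+1)d - u, which leaves x-degree exactly nd, where the height is
     0; as b does not decrease, b j <= b i. *)
  pose j := (i - (u - (d - i) - n * d))%N.
  have ji : (j <= i)%N by rewrite leq_subr.
  have jd := leq_trans ji id; have aj := exponent_ge jd.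
  have hj : (d - j <= u)%N by rewrite /j; lia.
  have e : (u - (d - j) = n * d)%N by rewrite /j; move: h h'; rewrite mulSn; lia.
  apply: leq_trans (height_le _ _ jd hj) _; rewrite e height_eq0 // addn0.
  have := shifted_nondecr ji id; rewrite /j in aj *; move: h h'; rewrite mulSn; lia.
have [i [hi ->]] := height_attain d a n u.
have id : (i <= d)%N by rewrite -ltnS.
have ai := exponent_ge id.
have := IH (u - (d - i))%N => h.
case: (leqP (n.+1 * d) u) => hu; first by rewrite height_eq0 ?a0; lia.
case: (leqP (u - (d - i)) (n * d)) => h'.
  have := height_le b n id hi; move: hu; rewrite mulSn; lia.
have z : height d b n (u - (d - i)) = 0%N by apply: height_eq0; [rewrite /= a0|exact: ltnW].
by have := height_le b n id hi; move: hu; rewrite z mulSn; lia.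
Qed.

(** For u < nd the pair (u, v) for T(L) corresponds to (u, v + nd - u) for L; for u >= nd the height
    vanishes on both sides. *)
Lemma colon_height_shift : colon_height d a <-> colon_height d b.
Proof.
split=> h n u v hv.
  case: (leqP (n * d) u) => hu; first by rewrite height_eq0 ?a0.
  have := h n u (v + (n * d - u))%N; rewrite height_shift leq_add2r; apply=> i id.
  have := hv i id; have := exponent_ge id; rewrite height_shift mulSn; lia.
case: (leqP (n * d) u) => hu; first by rewrite height_eq0.
(* The test with x^d alone forces this bound, so that v - (nd - u) is a true subtraction. *)
have hle : (n * d - u <= v)%N.
  have := hv 0%N (leq0n _); rewrite height_shift a0 mulSn; lia.
rewrite height_shift addnC -leq_subRL //; apply: h => i id.
have := hv i id; have := exponent_ge id; rewrite height_shift mulSn; lia.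
Qed.

Variable k : fieldType.

(** On the support of c the x-degree before multiplication is at most nd, so passing from b to a
    adds (n+1)d - u to both sides of the equality tested by [op]. *)
Lemma op_shift n i (c : {poly k}) : (size c <= (n * d).+1)%N -> (i <= d)%N ->
  op d a n i c = op d b n i c.
Proof.
move=> hc id; apply/polyP => u; rewrite !coef_op.
case: (leqP (d - i) u) => //= hu.
case: (leqP (size c) (u - (d - i))) => hs; first by rewrite coef_over //; do !case: ifP.
congr (if _ then _ else _); rewrite !height_shift mulSn.
have := exponent_ge id; lia.
Qed.

Lemma pop_shift n (c : {poly k}) : (size c <= (n * d).+1)%N ->
  pop d a n c = pop d b n c.
Proof. by move=> hc; apply: eq_big_nat => i hi; rewrite op_shift. Qed.

Lemma fiber_socle_shift : fiber_socle k d a <-> fiber_socle k d b.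
Proof.
split=> h n c hc hg.
  have [i id|g sg e] := h n c hc; last by exists g => //; rewrite -pop_shift.
  by have [g sg e] := hg i id; exists g => //; rewrite op_shift // e pop_shift.
have [i id|g sg e] := h n c hc; last by exists g => //; rewrite pop_shift.
by have [g sg e] := hg i id; exists g => //; rewrite -op_shift // e pop_shift.
Qed.
End Comparison.

Lemma lexL_gens (k : fieldType) d a : lexL k d a = gens k ord0 ord_max d a.
Proof. by apply: eq_map => i; rewrite /generator monoE. Qed.

Lemma transT_gens (k : fieldType) d a :
  transT k d a = gens k ord_max ord0 d (fun i => a i - i)%N.
Proof. by apply: eq_map => i; rewrite /generator monoE. Qed.

Lemma ideal_var0 (k : fieldType) : ideal_of [:: var0 k; var1 k] 0.
Proof. by exists [:: 0; 0]; rewrite !big_ord_recl big_ord0 /= !mul0r !addr0. Qed.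

Lemma ideal_varP (k : fieldType) (f : {mpoly k[2]}) : ideal_of [:: var0 k; var1 k] f ->
  exists s t, f = s * var0 k + t * var1 k.
Proof.
move=> [cs [_ ->]]; exists cs`_0, cs`_1.
by rewrite !big_ord_recl big_ord0 /= addr0.
Qed.

Theorem theorem4p4 (k : closedFieldType) (hchar : [pchar k] =i pred0)
    (d : nat) (a : nat -> nat)
    (ha0 : a 0%N = 0%N)
    (hinc : forall i, (i < d)%N -> (a i < a i.+1)%N)
    (had : (d < a d)%N) :
  forall r : nat,
    gr_depth_ge (ideal_of (lexL k d a)) (ideal_of [:: var0 k; var1 k]) r <->
    gr_depth_ge (ideal_of (transT k d a)) (ideal_of [:: var0 k; var1 k]) r.
Proof.
move=> r; rewrite lexL_gens transT_gens.
have m0 := ideal_var0 k; have mP := @ideal_varP k.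
have b0 : (a 0 - 0 = 0)%N by rewrite ha0.
have bd : (0 < a d - d)%N by lia.
have ad : (0 < a d)%N by lia.
have e1 := colon_height_shift ha0 hinc; have e2 := fiber_socle_shift ha0 hinc k.
have mP1 f : ideal_of [:: var0 k; var1 k] f -> exists s t,
    f = s * mono k ord0 ord_max 1 0 + t * mono k ord0 ord_max 0 1.
  by move=> /mP; rewrite !monoE !expr0 !expr1 mulr1 mul1r.
(* For T(L) the second variable z takes the place of x, so the two cofactors are swapped. *)
have mP2 f : ideal_of [:: var0 k; var1 k] f -> exists s t,
    f = s * mono k ord_max ord0 1 0 + t * mono k ord_max ord0 0 1.
  by move=> /mP [s [t ->]]; exists t, s; rewrite !monoE !expr0 !expr1 mulr1 mul1r addrC.
have ne : (ord0 : 'I_2) != ord_max by [].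
have ne' : (ord_max : 'I_2) != ord0 by [].
rewrite (gr_depth_ge_iff ne ha0 ad m0 mP1).
rewrite (@gr_depth_ge_iff k _ _ ne' d (fun i => a i - i)%N b0 bd _ m0 mP2).
by split=> -[r2 hc hf]; split=> // h; [apply/e1/hc|apply/e2/hf|apply/e1/hc|apply/e2/hf].
Qed.
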